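(* Let $E$ be a $\sigma$-MV-effect algebra. The set $\mathcal{BO}(E)$ of bounded observables on $E$ is a distributive lattice under the Olson order $\preceq_s$, and it is a lattice-ordered semigroup with respect to the sum $+$ of observables and the Olson order.
   Context: An effect algebra is a partial algebra $(E;+,0,1)$ with a partial binary operation $+$ such that for all $a,b,c\in E$: (i) $a+b$ is defined iff $b+a$ is, and then $a+b=b+a$; (ii) $a+b$ and $(a+b)+c$ are defined iff $b+c$ and $a+(b+c)$ are, and then $(a+b)+c=a+(b+c)$; (iii) for each $a$ there is a unique $a'\in E$ with $a+a'=1$; (iv) if $a+1$ is defined then $a=0$. It is partially ordered by $a\le b$ iff $a+c=b$ for some $c\in E$. An MV-effect algebra is an effect algebra that is a lattice under $\le$ and in which $a\wedge b=0$ implies that $a+b$ is defined. A $\sigma$-MV-effect algebra is an MV-effect algebra in which all countable joins and meets exist. An observable on $E$ is a mapping $x:\mathcal B(\mathbb R)\to E$ ($\mathcal B(\mathbb R)$ the Borel $\sigma$-algebra of $\mathbb R$) such that (i) $x(\mathbb R)=1$; (ii) if $A\cap B=\emptyset$ then $x(A)+x(B)$ is defined and $x(A\cup B)=x(A)+x(B)$; (iii) if $A_i\subseteq A_{i+1}$ for each $i$ and $\bigcup_iA_i=A$, then $x(A)=\bigvee_ix(A_i)$. It is bounded if $x([\alpha,\beta])=1$ for some interval $[\alpha,\beta]$. Put $B_x(t):=x((-\infty,t))$, $t\in\mathbb R$; the system $\{B_x(t):t\in\mathbb R\}$ is the spectral resolution of $x$ and determines $x$ uniquely. Sum of bounded observables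 $x,y$ on $E$: $x+y$ is the unique bounded observable on $E$ whose spectral resolution is $B_{x+y}(t)=\bigvee_{r\in\mathbb Q}(B_x(r)\wedge B_y(t-r))$, $t\in\mathbb R$. Olson order: $x\preceq_s y$ iff $B_y(t)\le B_x(t)$ for each $t\in\mathbb R$. A semigroup with a partial order $\preceq$ is a partially ordered semigroup if $x\preceq y$ implies $x+z\preceq y+z$ for all $x,y,z$; it is a lattice-ordered semigroup if it is a lattice under $\preceq$ and $(x\vee y)+z=(x+z)\vee(y+z)$ for all $x,y,z$. *)

(* Defs.v *)
From Stdlib Require Relation_Definitions.
From mathcomp Require Import all_boot all_order all_algebra.
From mathcomp Require Import all_classical all_reals all_analysis.

Set Implicit Arguments.
Unset Strict Implicit.
Unset Printing Implicit Defensive.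

Import Order.TTheory GRing.Theory Num.Theory.
Local Open Scope classical_set_scope.
Local Open Scope ring_scope.

(* The orders below (the one induced by a partial sum, the Olson order) are
   Prop-valued relations, hence the order theory is stated for T -> T -> Prop. *)
Section OrderNotions.
Context {T : Type}.
Implicit Types (le : T -> T -> Prop) (S : set T) (join meet add : T -> T -> T).

Definition is_sup le S (s : T) : Prop :=
  (forall a, S a -> le a s) /\ (forall b, (forall a, S a -> le a b) -> le s b).

Definition is_inf le S (s : T) : Prop :=
  (forall a, S a -> le s a) /\ (forall b, (forall a, S a -> le b a) -> le b s).

Record lattice_with le join meet : Prop := {
  lattice_order : Relation_Definitions.order T le;
  lattice_joinP : forall a b, is_sup le [set a; b] (join a b);
  lattice_meetP : forall a b, is_inf le [set a; b] (meet a b) }.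

(* [join] and [meet] are determined by [le]. *)
Definition is_lattice le : Prop :=
  exists join meet, lattice_with le join meet.

Definition is_distributive_lattice le : Prop :=
  exists join meet, lattice_with le join meet /\ left_distributive meet join.

Definition is_po_semigroup add le : Prop :=
  [/\ associative add, Relation_Definitions.order T le &
      forall a b c, le a b -> le (add a c) (add b c)].

Definition is_lattice_ordered_semigroup add le : Prop :=
  is_po_semigroup add le /\
  exists join meet, lattice_with le join meet /\ left_distributive add join.

End OrderNotions.

(* [padd a b = Some c] means that a + b is defined and equal to c. *)
Record effectAlgebra := EffectAlgebra {
  ea_sort :> Type;
  padd : ea_sort -> ea_sort -> option ea_sort;
  ea0 : ea_sort;
  ea1 : ea_sort;
  paddC : forall a b, padd a b = padd b a;
  paddA : forall a b c,
    obind (fun ab => padd ab c) (padd a b) =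
    obind (fun bc => padd a bc) (padd b c);
  ea_compl : forall a, exists! a', padd a a' = Some ea1;
  padd_ea1 : forall a, padd a ea1 <> None -> a = ea0 }.

Arguments ea0 {e}.
Arguments ea1 {e}.

Section EffectAlgebraOrder.
Variable E : effectAlgebra.

Definition ea_le (a b : E) : Prop := exists c, padd a c = Some b.

Definition is_MV_effect_algebra : Prop :=
  is_lattice ea_le /\
  (forall a b : E, is_inf ea_le [set a; b] ea0 -> padd a b <> None).

Definition is_sigma_MV_effect_algebra : Prop :=
  is_MV_effect_algebra /\
  (forall S : set E, countable S ->
     (exists s, is_sup ea_le S s) /\ (exists s, is_inf ea_le S s)).

End EffectAlgebraOrder.

Section Observables.
Variables (R : realType) (E : effectAlgebra).

Record borel := Borel {
  borel_set :> set R;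
  borel_measurable : measurable borel_set }.

Definition borel_itv (i : interval R) : borel := Borel (measurable_itv i).

Record is_observable (x : borel -> E) : Prop := {
  observableT : x (Borel measurableT) = ea1;
  observableU : forall A B : borel, A `&` B = set0 ->
    padd (x A) (x B) =
    Some (x (Borel (measurableU _ _ (borel_measurable A)
                                    (borel_measurable B))));
  observable_bigcup : forall A : nat -> borel,
    (forall i, A i `<=` A i.+1) ->
    is_sup (@ea_le E) (range (fun i => x (A i)))
      (x (Borel (bigcupT_measurable _ (fun i => borel_measurable (A i))))) }.

Definition is_bounded (x : borel -> E) : Prop :=
  exists alpha beta : R, x (borel_itv `[alpha, beta]) = ea1.

Record boundedObservable := BoundedObservable {
  bobs_fun :> borel -> E;
  bobs_observable : is_observable bobs_fun;
  bobs_bounded : is_bounded bobs_fun }.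

Definition spectral_resolution (x : borel -> E) (t : R) : E :=
  x (borel_itv `]-oo, t[).

Definition olson_le (x y : boundedObservable) : Prop :=
  forall t : R, ea_le (spectral_resolution y t) (spectral_resolution x t).

(* The spectral resolution of z is the one prescribed for x + y; m r is the
   meet of B_x(r) and B_y(t - r). *)
Definition is_observable_sum (x y z : boundedObservable) : Prop :=
  forall t : R, exists2 m : rat -> E,
    forall r : rat, is_inf (@ea_le E)
      [set spectral_resolution x (ratr r);
           spectral_resolution y (t - ratr r)] (m r)
    & is_sup (@ea_le E) (range m) (spectral_resolution z t).

End Observables.

(* Main.v *)
Require Import Defs.
From mathcomp Require Import all_boot all_order all_algebra.
From mathcomp Require Import all_classical all_reals all_analysis.
From mathcomp Require Import measurable_realfun lra.

Set Implicit Arguments.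
Unset Strict Implicit.
Unset Printing Implicit Defensive.

Import Order.TTheory GRing.Theory Num.Theory.
Import numFieldNormedType.Exports.
Local Open Scope classical_set_scope.

(**
Everything about the Olson order and the sum is pointwise computation with
spectral resolutions, once one knows which functions [F : R -> E] are spectral
resolutions of bounded observables: exactly the increasing, left-continuous
ones that are [0] far to the left and [1] far to the right
([spectral_resolution_family], [spectral_family_observable]), the observable
being determined by [F] ([spectral_resolution_inj], a pi-lambda argument). Such
functions are closed under pointwise meet, pointwise join and the convolution
that defines the sum, because [E] satisfies the infinite distributive law
[emeet_sup]; the Olson join is the pointwise meet, the Olson meet is the
pointwise join, and the required identities follow from distributivity.

The difficulty is the existence of an observable with a given spectral
resolution, an extension problem for an [E]-valued measure. It is solved with
[0, 1]-valued states of [E], in a way that needs no representation of the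
whole of [E]. A state [h] turns [F] into a distribution function [h o F], which
has a Borel probability measure [mu h] ([quantile_measure]). Call [e] the value
at [A] if [h e = mu h A] for all states [h] that preserve some fixed countable
family of suprema ([determined]). The Borel sets that have a value form a
lambda-system containing the rays, so all of them have one. Values are unique
and monotone because states preserving any given countable family of suprema
still separate the points of [E] ([state_separation]). The restriction to
countable families cannot be avoided: in general no state preserves all
countable suprema.

For the separation theorem, take elements [a] not below [b]. A
Rasiowa-Sikorski construction gives a descending sequence of non-zero elements
along which [a] exceeds [b] by a definite amount and each of the given suprema
is approached arbitrarily well. The elements disjoint from some term of the
sequence form a proper ideal; a maximal ideal above it is prime
([prime_ideal_above]), and the quotient by a prime ideal is a linearly ordered
effect algebra ([quot_linear]). A linearly ordered effect algebra has a state,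
written down through binary digits; its additivity holds because the defect
[h a + h b - h c] of a sum [c = a + b] is, up to sign, half the defect of
another sum ([binary_valueD]). *)

(** * Partial sums in an effect algebra *)

Local Notation "a [+] b [=] c" := (padd a b = Some c)
  (at level 70, b at next level, c at next level).
Local Notation "a [<=] b" := (ea_le a b) (at level 70, b at next level).



Section EffectAlgebraTheory.
Variable E : effectAlgebra.
Implicit Types a b c d e f : E.

Lemma psumC a b c : a [+] b [=] c -> b [+] a [=] c.
Proof. by rewrite paddC. Qed.

Lemma psum_fun a b c d : a [+] b [=] c -> a [+] b [=] d -> c = d.
Proof. by move=> -> []. Qed.

Lemma psumA a b c ab abc : a [+] b [=] ab -> ab [+] c [=] abc ->
  exists2 bc, b [+] c [=] bc & a [+] bc [=] abc.
Proof.
move=> h1 h2; have := paddA a b c; rewrite h1 /= h2.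
by case: (padd b c) => [bc|//] /= hbc; exists bc.
Qed.

Lemma psumAC a b c ab abc : a [+] b [=] ab -> ab [+] c [=] abc ->
  exists2 ac, a [+] c [=] ac & ac [+] b [=] abc.
Proof.
move=> /psumC h1 h2; have [ac h3 h4] := psumA h1 h2.
by exists ac => //; exact: psumC.
Qed.

Lemma psumCA a b c bc abc : b [+] c [=] bc -> a [+] bc [=] abc ->
  exists2 ab, a [+] b [=] ab & ab [+] c [=] abc.
Proof.
move=> /psumC h1 /psumC h2; have [ab h3 h4] := psumA h1 h2.
by exists ab; exact: psumC.
Qed.

Lemma psumACA a b c d ab cd abcd :
    a [+] b [=] ab -> c [+] d [=] cd -> ab [+] cd [=] abcd ->
  exists ac bd, [/\ a [+] c [=] ac, b [+] d [=] bd & ac [+] bd [=] abcd].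
Proof.
move=> hab hcd h; have [abc h1 h2] := psumCA hcd h.
have [ac h3 h4] := psumAC hab h1; have [bd h5 h6] := psumA h4 h2.
by exists ac, bd.
Qed.

Definition compl a : E := sval (cid (ea_compl a)).

Lemma psum_compl a : a [+] compl a [=] ea1.
Proof. by rewrite /compl; case: cid => b [] /=. Qed.

Lemma compl_unique a b : a [+] b [=] ea1 -> b = compl a.
Proof. by rewrite /compl; case: cid => c [/= _ cu] /cu. Qed.

Lemma complK : involutive compl.
Proof. by move=> a; apply/esym/compl_unique/psumC/psum_compl. Qed.

Lemma compl1 : compl ea1 = ea0 :> E.
Proof. by apply: padd_ea1; rewrite paddC psum_compl. Qed.

Lemma psumr0 a : a [+] ea0 [=] a.
Proof.
have h1 : @ea1 E [+] ea0 [=] ea1 by rewrite -compl1 psum_compl.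
have [b h2 h3] := psumA (psumC (psum_compl a)) h1.
by rewrite h2 (compl_unique h3) complK.
Qed.

Lemma psum0r a : ea0 [+] a [=] a. Proof. exact/psumC/psumr0. Qed.

(** With [d'] the complement of [d], both [b] and [c] are the complement of
    [a + d'], and complements are unique. *)
Lemma psumI a b c d : a [+] b [=] d -> a [+] c [=] d -> b = c.
Proof.
move=> hb hc; have hd := psum_compl d.
have [x hx /compl_unique ->] := psumAC hb hd.
have [y hy /compl_unique ->] := psumAC hc hd.
by rewrite (psum_fun hy hx).
Qed.

Lemma psum_eq0 a b : a [+] b [=] ea0 -> a = ea0.
Proof.
move=> hab; have [c h1 h2] := psumAC hab (psum0r ea1).
by apply: padd_ea1; rewrite h1.
Qed.

Lemma ea_lexx a : a [<=] a. Proof. by exists ea0; exact: psumr0. Qed.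

Lemma ea_le_trans b a c : a [<=] b -> b [<=] c -> a [<=] c.
Proof. by move=> [x hx] [y hy]; have [z _ h] := psumA hx hy; exists z. Qed.

Lemma ea_le_anti a b : a [<=] b -> b [<=] a -> a = b.
Proof.
move=> [x hx] [y hy]; have [z hz h] := psumA hx hy.
have z0 := psumI h (psumr0 a); rewrite z0 in hz.
by apply: psum_fun (psumr0 a) _; rewrite -(psum_eq0 hz).
Qed.

Lemma ea_le0x a : ea0 [<=] a. Proof. by exists a; exact: psum0r. Qed.

Lemma ea_lex1 a : a [<=] ea1. Proof. by exists (compl a); exact: psum_compl. Qed.

Lemma ea_lex0 a : a [<=] ea0 -> a = ea0.
Proof. by move=> h; apply: ea_le_anti h (ea_le0x a). Qed.

Lemma psum_lel a b c : a [+] b [=] c -> a [<=] c. Proof. by exists b. Qed.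

Lemma psum_ler a b c : a [+] b [=] c -> b [<=] c.
Proof. by move/psumC; exists a. Qed.

Lemma psum_le a b a1 b1 c1 : a [<=] a1 -> b [<=] b1 -> a1 [+] b1 [=] c1 ->
  exists2 c, a [+] b [=] c & c [<=] c1.
Proof.
move=> [x hx] [y hy] h; have [c [d [h1 h2 h3]]] := psumACA hx hy h.
by exists c => //; exists d.
Qed.

Lemma psum_leI a b c ab ac : a [+] b [=] ab -> a [+] c [=] ac ->
  ab [<=] ac -> b [<=] c.
Proof.
move=> hb hc [x hx]; have [y hy h] := psumA hb hx.
by rewrite (psumI hc h); exists x.
Qed.

Lemma psum_le_mono a b c ab ac : a [+] b [=] ab -> a [+] c [=] ac ->
  b [<=] c -> ab [<=] ac.
Proof.
move=> hb hc h; have [d hd] := psum_le (ea_lexx a) h hc.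
by rewrite (psum_fun hb hd).
Qed.

Lemma compl_le a b : a [<=] b -> compl b [<=] compl a.
Proof.
move=> [c h]; have [d hd h2] := psumA h (psum_compl b).
by rewrite -(compl_unique h2); apply: psum_ler hd.
Qed.

Lemma psum_definedE a b : (exists c, a [+] b [=] c) <-> a [<=] compl b.
Proof.
split=> [[c hc]|h].
  have [d h1 /psumC h2] := psumAC hc (psum_compl c).
  by rewrite -(compl_unique h2); exists (compl c).
have [c hc _] := psum_le h (ea_lexx b) (psumC (psum_compl b)).
by exists c.
Qed.

(** The value [ea0] when [a] is not below [b] only makes the function total. *)
Definition ediff b a : E :=
  if pselect (a [<=] b) is left h then sval (cid h) else ea0.

Lemma ediffP a b : a [<=] b -> a [+] ediff b a [=] b.
Proof. by rewrite /ediff; case: pselect => // h _; case: cid. Qed.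

Lemma ediffE a b c : a [+] b [=] c -> ediff c a = b.
Proof. by move=> h; apply: psumI (ediffP (psum_lel h)) h. Qed.

Lemma ediff_eq0 a b : a [<=] b -> ediff b a = ea0 -> a = b.
Proof. by move=> h h0; have := ediffP h; rewrite h0 psumr0 => -[]. Qed.

Lemma ediff_le a b : a [<=] b -> ediff b a [<=] b.
Proof. by move/ediffP/psum_ler. Qed.

Lemma ediff_le_anti a b c : a [<=] b -> b [<=] c -> ediff c b [<=] ediff c a.
Proof.
move=> ab bc; have [d hd h2] := psumA (ediffP ab) (ediffP bc).
by rewrite (ediffE h2); exact: psum_ler hd.
Qed.

Lemma ediffK a b : a [<=] b -> ediff b (ediff b a) = a.
Proof. by move=> h; apply/ediffE/psumC/ediffP. Qed.

End EffectAlgebraTheory.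

(** * Lattice operations and truncated arithmetic in an MV-effect algebra *)

Section MVOperations.
Variable E : effectAlgebra.
Implicit Types a b : E.

Definition emeet a b : E :=
  if pselect (exists m, is_inf (@ea_le E) [set a; b] m) is left h
  then sval (cid h) else ea0.

Definition ejoin a b : E :=
  if pselect (exists m, is_sup (@ea_le E) [set a; b] m) is left h
  then sval (cid h) else ea0.

(** In the lattice-ordered group of which [E] is an interval, [tdiff a b] is
    the positive part of [a - b] and [oplus a b] is the minimum of [a + b] and
    the unit. *)
Definition tdiff a b : E := ediff a (emeet a b).

Definition oplus a b : E := odflt ea0 (padd a (emeet b (compl a))).

Fixpoint omul k a : E := if k is k'.+1 then oplus (omul k' a) a else ea0.

Definition vanishing (u : nat -> E) :=
  forall w, (forall n, w [<=] u n) -> w = ea0.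

Definition ea_nondecr (u : nat -> E) := forall n, u n [<=] u n.+1.

End MVOperations.

Section MVTheory.
Variable E : effectAlgebra.
Hypothesis mvE : is_MV_effect_algebra E.
Implicit Types a b c d e f p q s t w : E.

Lemma emeetP a b : is_inf (@ea_le E) [set a; b] (emeet a b).
Proof.
rewrite /emeet; case: pselect => [h|[]]; first by case: cid.
by have [[j [m L]] _] := mvE; exists (m a b); exact: lattice_meetP L a b.
Qed.

Lemma ejoinP a b : is_sup (@ea_le E) [set a; b] (ejoin a b).
Proof.
rewrite /ejoin; case: pselect => [h|[]]; first by case: cid.
by have [[j [m L]] _] := mvE; exists (j a b); exact: lattice_joinP L a b.
Qed.

Lemma emeet_lel a b : emeet a b [<=] a.
Proof. by apply: (emeetP a b).1; left. Qed.

Lemma emeet_ler a b : emeet a b [<=] b.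
Proof. by apply: (emeetP a b).1; right. Qed.

Lemma emeet_glb w a b : w [<=] a -> w [<=] b -> w [<=] emeet a b.
Proof. by move=> ha hb; apply: (emeetP a b).2 => _ [->|->]. Qed.

Lemma ejoin_gel a b : a [<=] ejoin a b.
Proof. by apply: (ejoinP a b).1; left. Qed.

Lemma ejoin_ger a b : b [<=] ejoin a b.
Proof. by apply: (ejoinP a b).1; right. Qed.

Lemma ejoin_lub w a b : a [<=] w -> b [<=] w -> ejoin a b [<=] w.
Proof. by move=> ha hb; apply: (ejoinP a b).2 => _ [->|->]. Qed.

Lemma emeetC a b : emeet a b = emeet b a.
Proof.
by apply: ea_le_anti; apply: emeet_glb;
  (exact: emeet_lel || exact: emeet_ler).
Qed.

Lemma emeet_idPl a b : a [<=] b -> emeet a b = a.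
Proof.
by move=> h; apply: ea_le_anti (emeet_lel _ _) (emeet_glb (ea_lexx _) h).
Qed.

Lemma emeet_le a b c d : a [<=] b -> c [<=] d -> emeet a c [<=] emeet b d.
Proof.
by move=> h k; apply: emeet_glb;
  [apply: ea_le_trans (emeet_lel _ _) h|apply: ea_le_trans (emeet_ler _ _) k].
Qed.

Lemma ejoin_le a b c d : a [<=] b -> c [<=] d -> ejoin a c [<=] ejoin b d.
Proof.
by move=> h k; apply: ejoin_lub;
  [apply: ea_le_trans h (ejoin_gel _ _)|apply: ea_le_trans k (ejoin_ger _ _)].
Qed.

Lemma disjoint_le a b c d : a [<=] b -> c [<=] d -> emeet b d = ea0 ->
  emeet a c = ea0.
Proof. by move=> h k h0; apply: ea_lex0; rewrite -h0; exact: emeet_le. Qed.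

Lemma psum_tdiff a b : emeet a b [+] tdiff a b [=] a.
Proof. exact/ediffP/emeet_lel. Qed.

Lemma tdiff_le a b : tdiff a b [<=] a.
Proof. exact: psum_ler (psum_tdiff a b). Qed.

Lemma tdiff_eq0 a b : tdiff a b = ea0 -> a [<=] b.
Proof.
by move/(ediff_eq0 (emeet_lel a b)) => {1}<-; exact: emeet_ler.
Qed.

(** Adding a common lower bound of the two differences to [a /\ b] gives again
    a lower bound of [a] and [b]. *)
Lemma tdiff_disjoint a b : emeet (tdiff a b) (tdiff b a) = ea0.
Proof.
set w := emeet _ _; pose m := emeet a b.
have [x hx xa] := psum_le (ea_lexx m) (emeet_lel _ _ : w [<=] _) (psum_tdiff a b).
have [y hy yb] : exists2 y, m [+] w [=] y & y [<=] b.
  apply: psum_le (ea_lexx _) (emeet_ler _ _) _.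
  by rewrite /m emeetC; exact: psum_tdiff.
rewrite (psum_fun hy hx) in yb.
have xm : x [<=] m by exact: emeet_glb.
exact/ea_lex0/(psum_leI hx (psumr0 m)).
Qed.

(** In [[0, c]] the map [w |-> c - w] is an order-reversing involution, so
    [c - (p \/ q) = (c - p) /\ (c - q) = q /\ p = 0]. *)
Lemma psum_disjoint p q : emeet p q = ea0 -> p [+] q [=] ejoin p q.
Proof.
move=> pq0; have [_ /(_ p q)] := mvE; rewrite -{1}pq0.
move=> /(_ (emeetP p q)); case hpq: (padd p q) => [c|//] _.
have jc : ejoin p q [<=] c.
  by apply: ejoin_lub; [exact: psum_lel hpq|exact: psum_ler hpq].
congr Some; apply/esym/(ediff_eq0 jc)/ea_lex0; rewrite -pq0.
apply: emeet_glb.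
  by have := ediff_le_anti (ejoin_ger p q) jc; rewrite (ediffE (psumC hpq)).
by have := ediff_le_anti (ejoin_gel p q) jc; rewrite (ediffE hpq).
Qed.

(** The compatibility of any two elements, on which all the arithmetic of
    MV-effect algebras rests: with [m = a /\ b], the two differences [a - m]
    and [b - m] are disjoint, so their sum is their join, which stays below
    the complement of [m]. *)
Lemma psum_ejoin a b : b [+] tdiff a b [=] ejoin a b.
Proof.
set p := tdiff a b; set q := tdiff b a; set m := emeet a b.
have hp : m [+] p [=] a := psum_tdiff a b.
have hq : m [+] q [=] b by rewrite /m emeetC; exact: psum_tdiff.
have hpq := psum_disjoint (tdiff_disjoint a b); rewrite -/p -/q in hpq.
have [j hj] : exists j, ejoin p q [+] m [=] j.
  apply/psum_definedE/ejoin_lub; apply/psum_definedE.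
    by exists a; exact/psumC.
  by exists b; exact/psumC.
have [b' hb' hj'] := psumA hpq hj.
rewrite -(psum_fun (psumC hq) hb') in hj'.
rewrite (psumC hj'); congr Some; apply: ea_le_anti; last first.
  apply: ejoin_lub; last exact: psum_ler hj'.
  have [a' ha' hja] := psumAC hpq hj.
  by rewrite (psum_fun hp (psumC ha')); exists q.
set w := ejoin a b.
have mw : m [<=] w := ea_le_trans (emeet_lel _ _) (ejoin_gel _ _).
apply: psum_le_mono (psumC hj) (ediffP mw) _.
apply: ejoin_lub.
  exact: psum_leI hp (ediffP mw) (ejoin_gel _ _).
exact: psum_leI hq (ediffP mw) (ejoin_ger _ _).
Qed.

Lemma tdiff_compl a b : tdiff a b [<=] compl b.
Proof.
by apply/psum_definedE; exists (ejoin a b); exact/psumC/psum_ejoin.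
Qed.

Lemma tdiff_anti a b c : b [<=] c -> tdiff a c [<=] tdiff a b.
Proof.
by move=> bc; apply: ediff_le_anti (emeet_lel _ _); exact: emeet_le (ea_lexx a) bc.
Qed.

Lemma tdiff_mono a b c : a [<=] b -> tdiff a c [<=] tdiff b c.
Proof.
move=> ab; apply: psum_leI (psum_ejoin a c) (psum_ejoin b c) _.
exact: ejoin_le ab (ea_lexx c).
Qed.

(** The Riesz decomposition property: [w <= a + b] splits as
    [(w /\ a) + (w - w /\ a)]. *)
Lemma tdiff_le_psum a b c w : a [+] b [=] c -> w [<=] c -> tdiff w a [<=] b.
Proof.
move=> h wc; apply: (psum_leI (psum_ejoin w a) h).
exact: ejoin_lub wc (psum_lel h).
Qed.

(** By Riesz decomposition, an element below both [a + b] and [f] is a sum of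
    an element below [a] and [f] and one below [b] and [f]. *)
Lemma disjoint_psum a b c f : a [+] b [=] c -> emeet a f = ea0 ->
  emeet b f = ea0 -> emeet c f = ea0.
Proof.
move=> h af bf; set w := emeet c f.
have wf : w [<=] f := emeet_ler _ _.
have w1 : emeet w a = ea0.
  by rewrite emeetC; apply: disjoint_le (ea_lexx a) wf af.
have wb : tdiff w a [<=] b := tdiff_le_psum h (emeet_lel _ _).
have := psum_tdiff w a; rewrite w1 psum0r => -[] wE; rewrite wE in wb.
by apply: ea_lex0; rewrite -bf; exact: emeet_glb.
Qed.

(** The infinite distributive law: if [b /\ a <= c] for all [b] in [S], then
    every [b] is at most [(c /\ a) + (s - s /\ a)], hence so is [s]; cancel. *)
Lemma emeet_sup S s a c : is_sup (@ea_le E) S s ->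
  (forall b, S b -> emeet b a [<=] c) -> emeet s a [<=] c.
Proof.
move=> [Ss sS] h.
have [t ht tj] := psum_le (emeet_ler c a) (ea_lexx _) (psum_ejoin s a).
have st : s [<=] t.
  apply: sS => b Sb; have ba := tdiff_mono a (Ss _ Sb).
  have bc : emeet b a [<=] emeet c a := emeet_glb (h _ Sb) (emeet_ler _ _).
  by have [b' hb' ?] := psum_le bc ba ht; rewrite (psum_fun (psum_tdiff b a) hb').
apply: ea_le_trans (emeet_lel c a).
exact: psum_leI (psumC (psum_tdiff s a)) (psumC ht) st.
Qed.

Lemma psum_oplus a b : a [+] emeet b (compl a) [=] oplus a b.
Proof.
rewrite /oplus; have [c ->//] : exists c, a [+] emeet b (compl a) [=] c.
have [c hc _] := psum_le (ea_lexx a) (emeet_ler b (compl a)) (psum_compl a).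
by exists c.
Qed.

(** This adjunction stands in for the axioms of truncated addition: monotony
    and limits of [oplus] are read off from those of [tdiff]. *)
Lemma le_oplusE w a b : w [<=] oplus a b <-> tdiff w a [<=] b.
Proof.
split=> h.
  apply: ea_le_trans (emeet_lel b (compl a)).
  exact: tdiff_le_psum (psum_oplus a b) h.
have h2 : tdiff w a [<=] emeet b (compl a) := emeet_glb h (tdiff_compl w a).
have [x hx] := psum_le (emeet_ler w a) h2 (psum_oplus a b).
by rewrite (psum_fun (psum_tdiff w a) hx).
Qed.

Lemma oplus_le a b c d : a [<=] c -> b [<=] d -> oplus a b [<=] oplus c d.
Proof.
move=> ac bd; apply/le_oplusE; apply: ea_le_trans (tdiff_anti _ ac) _.
by apply: ea_le_trans bd; apply/le_oplusE/ea_lexx.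
Qed.

Lemma omul_le k a b : a [<=] b -> omul k a [<=] omul k b.
Proof. by move=> ab; elim: k => [|k IH] /=; [exact: ea_lexx|exact: oplus_le]. Qed.

Lemma oplus_gel a b : a [<=] oplus a b.
Proof. exact: psum_lel (psum_oplus a b). Qed.

Lemma omul_mono k l a : (k <= l)%N -> omul k a [<=] omul l a.
Proof.
move=> /subnK <-; elim: (l - k)%N => [|n IH] /=; first exact: ea_lexx.
exact: ea_le_trans IH (oplus_gel _ _).
Qed.

(** The part of [a] lost when [a] is added to [b] with truncation lies on the
    region where the truncated sum is [1]. *)
Lemma oplus_error a b : emeet (tdiff a (compl b)) (compl (oplus b a)) = ea0.
Proof.
rewrite emeetC; apply: disjoint_le (ea_lexx _) (tdiff_disjoint (compl b) a).
have [c h1 h2] := psumA (psum_oplus b a) (psum_compl (oplus b a)).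
have := compl_unique h2 => cE; rewrite cE in h1.
rewrite /tdiff emeetC (ediffE h1); exact: ea_lexx.
Qed.

(** If [w <= oplus (u n) (v n)] for all [n], then [tdiff w (u n) <= v k] for all
    [n] and [k] by monotony; so [w - w /\ v k <= u n] for all [n], and [w <= v k]. *)
Lemma oplus_vanishing (u v : nat -> E) :
    (forall n, u n.+1 [<=] u n) -> (forall n, v n.+1 [<=] v n) ->
  vanishing u -> vanishing v -> vanishing (fun n => oplus (u n) (v n)).
Proof.
move=> du dv u0 v0 w hw.
have mono (t : nat -> E) : (forall n, t n.+1 [<=] t n) ->
    forall m n, (m <= n)%N -> t n [<=] t m.
  move=> dt m n /subnK <-; elim: (n - m)%N => [|i IH]; first exact: ea_lexx.
  exact: ea_le_trans (dt _) IH.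
have wv n k : tdiff w (u n) [<=] v k.
  have [nk|/ltnW kn] := leqP n k.
    apply: (@ea_le_trans _ (tdiff w (u k))); first exact/tdiff_anti/mono.
    exact/le_oplusE.
  apply: ea_le_trans (mono _ dv _ _ kn); exact/le_oplusE.
apply: v0 => k; apply/tdiff_eq0/u0 => n.
have h := ediff_le_anti (emeet_glb (tdiff_le w (u n)) (wv n k)) (emeet_lel _ _).
apply: ea_le_trans h _.
by rewrite ediffK; [exact: emeet_ler|exact: emeet_lel].
Qed.

Lemma omul_vanishing k (u : nat -> E) : (forall n, u n.+1 [<=] u n) ->
  vanishing u -> vanishing (fun n => omul k (u n)).
Proof.
move=> du u0; elim: k => [w /(_ 0%N)|k IH] /=; first exact: ea_lex0.
apply: oplus_vanishing => // n; exact: omul_le.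
Qed.

End MVTheory.

(** * Prime ideals and their quotients *)

Section Ideals.
Variable E : effectAlgebra.

Record is_ideal (I : set E) : Prop := {
  ideal0 : I ea0;
  ideal_le : forall a b, a [<=] b -> I b -> I a;
  idealD : forall a b c, a [+] b [=] c -> I a -> I b -> I c }.

Definition is_prime_ideal (I : set E) :=
  [/\ is_ideal I, ~ I ea1 & forall a b, emeet a b = ea0 -> I a \/ I b].

Lemma maximal_ideal (I0 : set E) : is_ideal I0 -> ~ I0 ea1 ->
  exists I : set E, [/\ is_ideal I, ~ I ea1, I0 `<=` I &
    forall J : set E, is_ideal J -> ~ J ea1 -> I `<=` J -> J `<=` I].
Proof.
move=> I0i I01.
(* The union with I0 keeps the empty chain from being an exception. *)
have [F FP totF|A [[Ai A1] Amax]] := @Zorn_bigcup E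
    [set X | is_ideal (X `|` I0) /\ ~ (X `|` I0) ea1]; last first.
  exists (A `|` I0); split=> [//|//|a I0a|]; first by right.
  move=> J Ji J1 AJ a Ja; left; apply: contrapT => Aa.
  have JE : J `|` I0 = J.
    apply/seteqP; split=> [b [//|I0b]|b Jb]; last by left.
    by apply: AJ; right.
  have AJ' : A `<` J.
    by split=> [b Ab|/(_ a Ja)//]; apply: AJ; left.
  suff : is_ideal (J `|` I0) /\ ~ (J `|` I0) ea1 by exact: Amax J AJ'.
  by rewrite JE.
have sub X a : F X -> (X `|` I0) a -> (\bigcup_(X in F) X `|` I0) a.
  by move=> FX [Xa|I0a]; [left; exists X|right].
split; last by move=> [[X FX X1]|//]; apply: (FP X FX).2; left.
split; first by right; exact: ideal0.
  move=> a b ab [[X FX Xb]|I0b]; last by right; exact: ideal_le ab I0b.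
  apply: (sub X) => //; have [Xi _] := FP X FX.
  by apply: (ideal_le Xi ab); left.
move=> a b c abc [[X FX Xa]|I0a] [[Y FY Yb]|I0b].
- have [XY|YX] := totF X Y FX FY.
    apply: (sub Y) => //; apply: (idealD (FP Y FY).1 abc); left => //.
    exact: XY.
  apply: (sub X) => //; apply: (idealD (FP X FX).1 abc); left => //.
  exact: YX.
- by apply: (sub X) => //; apply: (idealD (FP X FX).1 abc); [left|right].
- by apply: (sub Y) => //; apply: (idealD (FP Y FY).1 abc); [right|left].
- by right; exact: idealD abc I0a I0b.
Qed.

Hypothesis mvE : is_MV_effect_algebra E.

(** A maximal ideal [I] is prime: if [b] is not in [I], the elements [f] with
    [f /\ b] in [I] form a proper ideal above [I], hence [I] itself, and it
    contains every [a] disjoint from [b]. *)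
Lemma prime_ideal_above (I0 : set E) : is_ideal I0 -> ~ I0 ea1 ->
  exists2 I : set E, is_prime_ideal I & I0 `<=` I.
Proof.
move=> I0i I01; have [I [Ii I1 I0I Imax]] := maximal_ideal I0i I01.
exists I => //; split=> // a b ab; have [|Ib] := pselect (I b); first by right.
left; pose J : set E := fun f => I (emeet f b).
suff JI : J `<=` I by apply: JI; rewrite /J ab; exact: ideal0.
apply: Imax.
- split; rewrite /J.
  + by rewrite emeet_idPl//; [exact: ideal0|exact: ea_le0x].
  + by move=> f g fg; apply/(ideal_le Ii)/(emeet_le mvE fg)/ea_lexx.
  + move=> f g h fgh If Ig; set w := emeet h b.
    apply: (idealD Ii (psum_tdiff mvE w f)).
      apply: (ideal_le Ii) If; apply: (emeet_glb mvE).
        exact: emeet_ler.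
      by apply: ea_le_trans (emeet_lel mvE _ _) _; exact: emeet_ler.
    apply: (ideal_le Ii) Ig; apply: (emeet_glb mvE).
      by apply: (tdiff_le_psum mvE fgh); exact: emeet_lel.
    by apply: ea_le_trans (tdiff_le mvE _ _) _; exact: emeet_ler.
- by rewrite /J emeetC// emeet_idPl//; exact: ea_lex1.
- by move=> f; apply: (ideal_le Ii); exact: emeet_lel.
Qed.

Variable I : set E.
Hypothesis Ii : is_ideal I.

(** Equivalently both truncated differences of [a] and [b] lie in [I]. Witnesses
    given by a common lower bound [m] can be added term by term, which makes
    the compatibility with partial sums immediate. *)
Definition congr_mod (a b : E) :=
  exists m i j, [/\ m [+] i [=] a, m [+] j [=] b, I i & I j].

Lemma congr_mod_refl a : congr_mod a a.
Proof. by exists a, ea0, ea0; split; rewrite ?psumr0//; exact: ideal0. Qed.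

Lemma congr_mod_sym a b : congr_mod a b -> congr_mod b a.
Proof. by move=> [m [i [j []]]]; exists m, j, i. Qed.

Lemma congr_mod_tdiff a b : I (tdiff a b) -> I (tdiff b a) -> congr_mod a b.
Proof.
move=> ab ba; exists (emeet a b), (tdiff a b), (tdiff b a); split => //.
  exact: psum_tdiff.
by rewrite emeetC//; exact: psum_tdiff.
Qed.

Lemma congr_mod_trans b a c : congr_mod a b -> congr_mod b c -> congr_mod a c.
Proof.
move=> [m [i [j [hma hmb Ii1 Ij]]]] [n [k [l [hnb hnc Ik Il]]]].
have Imn : I (tdiff m n).
  by apply: (ideal_le Ii) Ik; apply: (tdiff_le_psum mvE hnb); exact: psum_lel hmb.
have Inm : I (tdiff n m).
  by apply: (ideal_le Ii) Ij; apply: (tdiff_le_psum mvE hmb); exact: psum_lel hnb.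
have [u hu h1] := psumA (psum_tdiff mvE m n) hma.
have [v hv h2] := psumA (psum_tdiff mvE n m) hnc.
exists (emeet m n), u, v; split => //.
- by rewrite emeetC.
- exact: idealD hu _ _.
- exact: idealD hv _ _.
Qed.

Lemma congr_mod_psum a b c a1 b1 c1 : congr_mod a a1 -> congr_mod b b1 ->
  a [+] b [=] c -> a1 [+] b1 [=] c1 -> congr_mod c c1.
Proof.
move=> [m [i [j [h1 h2 hi hj]]]] [n [k [l [h3 h4 hk hl]]]] h h'.
have [u [v [h5 h6 h7]]] := psumACA h1 h3 h.
have [u' [v' [h5' h6' h7']]] := psumACA h2 h4 h'.
rewrite (psum_fun h5' h5) in h7'.
by exists u, v, v'; split=> //; [exact: idealD h6 _ _|exact: idealD h6' _ _].
Qed.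

Lemma congr_mod0 a : congr_mod a ea0 <-> I a.
Proof.
split=> [[m [i [j [h1 h2 hi hj]]]]|Ia].
  by move: h1; rewrite (psum_eq0 h2) psum0r => -[<-].
by exists ea0, a, ea0; split; rewrite ?psum0r//; exact: ideal0.
Qed.

Lemma congr_mod1 a : congr_mod a ea1 <-> I (compl a).
Proof.
split=> [[m [i [j [h1 h2 hi hj]]]]|Ia].
  apply: (ideal_le Ii) hj; rewrite (compl_unique h2).
  exact/compl_le/(psum_lel h1).
exists a, ea0, (compl a); split; rewrite ?psumr0 ?psum_compl//; exact: ideal0.
Qed.

Lemma congr_mod_compl a b : congr_mod a b -> congr_mod (compl a) (compl b).
Proof.
move=> [m [i [j [h1 h2 hi hj]]]].
have [u hu /compl_unique uE] := psumA h1 (psum_compl a).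
have [v hv /compl_unique vE] := psumA h2 (psum_compl b).
rewrite {}uE in hu; rewrite {}vE in hv.
apply: congr_mod_tdiff.
  apply: (ideal_le Ii) hj; apply: (tdiff_le_psum mvE (psumC hv)).
  exact: psum_ler hu.
apply: (ideal_le Ii) hi; apply: (tdiff_le_psum mvE (psumC hu)).
exact: psum_ler hv.
Qed.

Definition quot := {X : set E | exists a, X = congr_mod a}.

Definition qclass a : quot := exist _ (congr_mod a) (ex_intro _ a erefl).

Lemma qclassP a b : qclass a = qclass b <-> congr_mod a b.
Proof.
split=> [[] ->|ab]; first exact: congr_mod_refl.
apply: eq_exist; apply/seteqP; split=> c /=; last exact: congr_mod_trans.
exact/congr_mod_trans/congr_mod_sym.
Qed.

Lemma qclass_surj X : exists a, X = qclass a.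
Proof. by case: X => X [a Xa]; exists a; exact: eq_exist. Qed.

Definition qsum (X Y Z : quot) := exists a b c,
  [/\ X = qclass a, Y = qclass b, Z = qclass c & a [+] b [=] c].

Definition qpadd X Y : option quot :=
  if pselect (exists Z, qsum X Y Z) is left h then Some (sval (cid h)) else None.

Lemma qpaddP X Y Z : qpadd X Y = Some Z <-> qsum X Y Z.
Proof.
have qfun Z1 Z2 : qsum X Y Z1 -> qsum X Y Z2 -> Z1 = Z2.
  move=> [a [b [c [-> -> -> h]]]] [a1 [b1 [c1 [aa bb -> h1]]]].
  by apply/qclassP/(congr_mod_psum _ _ h h1); apply/qclassP.
rewrite /qpadd; case: pselect => [h|nh]; last by split=> // h; case: nh; exists Z.
case: cid => Z1 /= h1; split=> [[<-//]|h2]; congr Some; exact: qfun.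
Qed.

Lemma option_ext (T : Type) (o1 o2 : option T) :
  (forall z, o1 = Some z <-> o2 = Some z) -> o1 = o2.
Proof.
case: o1 => [x|]; first by move=> /(_ x) [/(_ erefl) ->].
by case: o2 => [y|//] /(_ y) [_ /(_ erefl)].
Qed.

Lemma qsumC X Y Z : qsum X Y Z -> qsum Y X Z.
Proof. by move=> [a [b [c [-> -> -> /psumC h]]]]; exists b, a, c. Qed.

(** Regrouping [(a + b) + c], where the representative [d'] of the class of
    [d = a + b] used in the second sum differs from [d]: shrink [d] to a common
    lower bound and split that one along [a + b] by the Riesz property. *)
Lemma qsumA X Y Z U W : qsum X Y U -> qsum U Z W ->
  exists2 V, qsum Y Z V & qsum X V W.
Proof.
move=> [a [b [d [-> -> -> habd]]]] [d' [c [w [/qclassP dd -> -> hdcw]]]].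
have [m [i [i1 [hmd hmd1 hi hi1]]]] := dd.
have [a1a b1b] : emeet m a [<=] a /\ tdiff m a [<=] b.
  split; first exact: emeet_ler.
  by apply: (tdiff_le_psum mvE habd); exact: psum_lel hmd.
set a1 := emeet m a in a1a; set b1 := tdiff m a in b1b.
have hab1 : a1 [+] b1 [=] m := psum_tdiff mvE m a.
have [m' [k [h1 h2 h3]]] := psumACA (ediffP a1a) (ediffP b1b) habd.
rewrite -(psum_fun hab1 h1) in h3; rewrite (psumI h3 hmd) in h2.
have aa1 : congr_mod a a1.
  exists a1, (ediff a a1), ea0; split; rewrite ?psumr0//; first exact: ediffP.
    exact: ideal_le (psum_lel h2) _.
  exact: ideal0.
have bb1 : congr_mod b b1.
  exists b1, (ediff b b1), ea0; split; rewrite ?psumr0//; first exact: ediffP.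
    exact: ideal_le (psum_ler h2) _.
  exact: ideal0.
have [w1 hmc hw1] := psumAC hmd1 hdcw.
have ww1 : congr_mod w w1.
  by exists w1, i1, ea0; split; rewrite ?psumr0//; exact: ideal0.
have [v hv hav] := psumA hab1 hmc.
exists (qclass v); first by exists b1, c, v; split=> //; exact/qclassP.
by exists a1, v, w1; split=> //; exact/qclassP.
Qed.

Lemma qpaddC X Y : qpadd X Y = qpadd Y X.
Proof. by apply: option_ext => Z; split=> /qpaddP/qsumC/qpaddP. Qed.

Lemma qpaddA X Y Z :
  obind (fun XY => qpadd XY Z) (qpadd X Y) =
  obind (fun YZ => qpadd X YZ) (qpadd Y Z).
Proof.
apply: option_ext => W; split.
  case XY: (qpadd X Y) => [U|//] /= /qpaddP h.
  move/qpaddP in XY; have [V /qpaddP -> /qpaddP] := qsumA XY h; exact.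
case YZ: (qpadd Y Z) => [U|//] /= /qpaddP/qsumC h.
move/qpaddP/qsumC in YZ; have [V /qsumC/qpaddP -> /qsumC/qpaddP] := qsumA YZ h.
exact.
Qed.

Lemma qcompl X : exists! X', qpadd X X' = Some (qclass ea1).
Proof.
have [a ->] := qclass_surj X; exists (qclass (compl a)); split.
  by apply/qpaddP; exists a, (compl a), ea1; split=> //; exact: psum_compl.
move=> Y /qpaddP [a1 [b [c [/qclassP aa ->]]]].
move=> /qclassP/congr_mod_sym/congr_mod1 c1 h.
have [u hu /compl_unique uE] := psumA h (psum_compl c).
apply/qclassP/(congr_mod_trans (congr_mod_compl aa)); rewrite -uE.
by exists b, (compl c), ea0; split; rewrite ?psumr0//; exact: ideal0.
Qed.

Lemma qpadd1 X : qpadd X (qclass ea1) <> None -> X = qclass ea0.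
Proof.
case h: (qpadd _ _) => [Z|//] _; move/qpaddP: h => [a [b [c [-> ]]]].
move=> /qclassP/congr_mod_sym/congr_mod1 b1 _ h; apply/qclassP/congr_mod0.
by apply: (ideal_le Ii) b1; apply/psum_definedE; exists c.
Qed.

Definition quotEA := EffectAlgebra qpaddC qpaddA qcompl qpadd1.

(** [tdiff a b] and [tdiff b a] are disjoint, so one of them is in [I]. *)
Lemma quot_linear : (forall a b, emeet a b = ea0 -> I a \/ I b) ->
  forall X Y : quotEA, X [<=] Y \/ Y [<=] X.
Proof.
move=> primeI X Y; have [a ->] := qclass_surj X; have [b ->] := qclass_surj Y.
have le c d : I (tdiff c d) -> (qclass c : quotEA) [<=] qclass d.
  move=> cd; exists (qclass (tdiff d c)); apply/qpaddP.
  exists (emeet c d), (tdiff d c), d; split=> //; last first.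
    by rewrite emeetC//; exact: psum_tdiff.
  apply/qclassP/congr_mod_sym.
  exists (emeet c d), ea0, (tdiff c d); split; rewrite ?psumr0 ?psum_tdiff//.
  exact: ideal0.
by have [ab|ba] := primeI _ _ (tdiff_disjoint mvE a b); [left|right]; exact: le.
Qed.

End Ideals.

Local Open Scope ring_scope.

(** * States *)

Section States.
Context {R : realType} {E : effectAlgebra}.

Record is_state (h : E -> R) : Prop := {
  state_ge0 : forall a, 0 <= h a;
  state1 : h ea1 = 1;
  stateD : forall a b c, a [+] b [=] c -> h c = h a + h b }.

Variable h : E -> R.
Hypothesis hs : is_state h.

Lemma state0 : h ea0 = 0.
Proof. have := stateD hs (psumr0 ea0); lra. Qed.

Lemma state_compl a : h (compl a) = 1 - h a.
Proof. have := stateD hs (psum_compl a); rewrite state1//; lra. Qed.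

Lemma state_le a b : a [<=] b -> h a <= h b.
Proof. by move=> [c /(stateD hs)]; have := state_ge0 hs c; lra. Qed.

Lemma state_le1 a : h a <= 1.
Proof. by rewrite -(state1 hs); exact/state_le/ea_lex1. Qed.

End States.

Lemma normr_half (R : realFieldType) (x y : R) :
  x = y / 2 \/ x = - (y / 2) -> `|x| <= `|y| / 2.
Proof. by case=> ->; rewrite ?normrN normrM (@ger0_norm _ 2^-1). Qed.

(** Iterating the hypothesis gives [`|d x| <= B / 2 ^ n] for all [n]. *)
Lemma halving_eq0 (R : realType) (X : Type) (P : X -> Prop) (d : X -> R) (B : R) :
    (forall x, P x -> `|d x| <= B) ->
    (forall x, P x -> exists2 y, P y & `|d x| <= `|d y| / 2) ->
  forall x, P x -> d x = 0.
Proof.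
move=> dB half x0 Px0.
have bound n x : P x -> `|d x| <= geometric B 2^-1 n.
  elim: n x => [|n IH] x Px; first by rewrite /= expr0 mulr1 dB.
  have [y Py h] := half x Px; apply: le_trans h _.
  rewrite /= exprSr mulrA ler_pM2r ?invr_gt0//; exact: IH.
apply/eqP; rewrite -normr_eq0 eq_le normr_ge0 andbT.
have cv : geometric B (2^-1 : R) @ \oo --> (0 : R).
  by apply: cvg_geometric; rewrite ger0_norm ?invr_ge0// invf_lt1// ltr1n.
rewrite -(cvg_lim _ cv)//; apply: limr_ge; first exact: cvgP cv.
by apply: nearW => n; exact: bound.
Qed.

(** In a linearly ordered effect algebra a state is found by reading off binary
    digits: [digit a] tells whether [a] exceeds its complement, and [shift a]
    is [2 a] or [2 a - 1] accordingly. *)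
Section LinearState.
Context {R : realType} {E : effectAlgebra}.
Hypothesis linE : forall a b : E, a [<=] b \/ b [<=] a.
Hypothesis nontrivE : @ea0 E <> ea1.
Implicit Types a b c : E.

Definition digit a : bool := ~~ `[< a [<=] compl a >].

Definition shift a : E :=
  if digit a then ediff a (compl a) else odflt ea0 (padd a a).

Lemma shift_digit0 a : ~~ digit a -> a [+] a [=] shift a.
Proof.
move=> da; rewrite /shift (negbTE da); move: da; rewrite negbK => /asboolP.
by move=> /psum_definedE[c ->].
Qed.

Lemma shift_digit1 a : digit a -> compl a [+] shift a [=] a.
Proof.
move=> da; rewrite /shift da; apply: ediffP.
by move: da => /asboolPn; have [] := linE a (compl a).
Qed.

Fixpoint expansion n a : R :=
  if n is n'.+1 then ((digit a)%:R + expansion n' (shift a)) / 2 else 0.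

Lemma expansion_ge0 n a : 0 <= expansion n a.
Proof.
elim: n a => [//|n IH] a /=; apply: divr_ge0 => //.
exact/addr_ge0.
Qed.

Lemma expansion_le1 n a : expansion n a <= 1.
Proof.
elim: n a => [//|n IH] a /=; have := IH (shift a).
by case: (digit a) => /=; lra.
Qed.

Lemma expansion_cvg a : cvgn (expansion ^~ a).
Proof.
apply: nondecreasing_is_cvgn; last first.
  by exists 1 => _ [n _ <-]; exact: expansion_le1.
apply/nondecreasing_seqP => n; elim: n a => [|n IH] a.
  exact: expansion_ge0.
by rewrite [leLHS]/= [leRHS]/= ler_pM2r ?invr_gt0// lerD2l; exact: IH.
Qed.

Definition binary_value a : R := limn (expansion ^~ a).

Let h := binary_value.

Lemma binary_valueE a : h a = ((digit a)%:R + h (shift a)) / 2.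
Proof.
apply: cvg_lim => //; rewrite -cvg_shiftS /=.
apply: cvgMr_tmp; apply: cvgD; first exact: cvg_cst.
exact: expansion_cvg.
Qed.

Lemma binary_value_ge0 a : 0 <= h a.
Proof.
apply: limr_ge; first exact: expansion_cvg.
by apply: nearW => n; exact: expansion_ge0.
Qed.

Lemma binary_value_le1 a : h a <= 1.
Proof.
apply: limr_le; first exact: expansion_cvg.
by apply: nearW => n; exact: expansion_le1.
Qed.

Lemma binary_value1 : h ea1 = 1.
Proof.
have d1 : digit ea1.
  by apply/asboolPn; rewrite compl1 => /ea_lex0/esym.
have s1 : shift ea1 = ea1.
  by have := shift_digit1 d1; rewrite compl1 psum0r => -[].
have := binary_valueE ea1; rewrite d1 s1 /=; lra.
Qed.

Lemma digit_compl a : a <> compl a -> digit (compl a) = ~~ digit a.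
Proof.
move=> aa; rewrite /digit complK negbK.
have [h1|h1] := linE a (compl a).
  by rewrite (asboolT h1); apply/asboolPn => h2; apply/aa/ea_le_anti.
rewrite (asboolT h1) /=; apply/esym/negbTE/asboolPn => h2.
exact/aa/ea_le_anti.
Qed.

(** If [b] is at most its complement [b'], then [(2 b' - 1) + 2 b = 1]. *)
Lemma shift_compl a : a <> compl a -> shift (compl a) = compl (shift a).
Proof.
suff low b : b <> compl b -> ~~ digit b -> shift (compl b) = compl (shift b).
  move=> aa; have [da|] := boolP (digit a); last exact: low.
  have := low (compl a); rewrite !complK => ->; rewrite ?complK//.
    exact: nesym.
  by rewrite digit_compl// da.
move=> bb db; have := digit_compl bb; rewrite db => dcb.
have h1 := shift_digit0 db; have := shift_digit1 dcb; rewrite complK => h2.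
have [c hc] := psumCA h2 (psum_compl b).
by rewrite (psum_fun hc h1) => /compl_unique.
Qed.

Lemma binary_value_compl a : h a + h (compl a) = 1.
Proof.
apply/eqP; rewrite -subr_eq0; apply/eqP.
apply: (@halving_eq0 _ _ setT (fun a => h a + h (compl a) - 1) 1) => // {}a _.
  have := binary_value_ge0 a; have := binary_value_le1 a.
  have := binary_value_ge0 (compl a); have := binary_value_le1 (compl a).
  by rewrite ler_norml; lra.
have [aa|aa] := pselect (a = compl a).
  exists a => //; have da : ~~ digit a.
    by rewrite negbK; apply/asboolP; rewrite -aa; exact: ea_lexx.
  have s1 : shift a = ea1.
    by have := shift_digit0 da; rewrite {2}aa psum_compl => -[].
  have ha : h a = 2^-1.
    have := binary_valueE a; rewrite (negbTE da) s1 binary_value1 /=; lra.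
  rewrite -aa ha (_ : _ - 1 = 0) ?normr0 ?mul0r//; lra.
exists (shift a) => //.
rewrite [h a]binary_valueE [h (compl a)]binary_valueE digit_compl// shift_compl//.
by apply: normr_half; left; case: (digit a) => /=; lra.
Qed.

(** The step of the contraction where both [a] and [b] are at most [1/2] and
    their sum [c] is not: there [(2 b)' + (2 c - 1) = 2 a]. *)
Lemma shift_carry a b c : b [<=] a -> a [+] b [=] c ->
  ~~ digit a -> ~~ digit b -> digit c -> compl (shift b) [+] shift c [=] shift a.
Proof.
move=> [d hd] hc da db dc.
have ha2 := shift_digit0 da; have hb2 := shift_digit0 db.
have hc2 := shift_digit1 dc.
have [c' hc' hcd] := psumCA hd ha2; rewrite -(psum_fun hc hc') in hcd.
have [x hx hxa] := psumAC hc2 hcd.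
have [b2 hb2' hbd] := psumAC hd hc; rewrite -(psum_fun hb2 hb2') in hbd.
have [x' hx' hx1] := psumA hbd (psum_compl c).
by rewrite -(compl_unique hx1) -(psum_fun (psumC hx) hx').
Qed.

(** Doubling [a + b = c] leads to another sum: [(2 a) + (2 b) = 2 c] when no digit
    is set, [(2 a - 1) + (2 b) = 2 c - 1] when those of [a] and [c] are, and the sum
    of [shift_carry] when only that of [c] is. Both digits of [a] and [b] cannot be
    set. *)
Lemma binary_valueD a b c : a [+] b [=] c -> h c = h a + h b.
Proof.
move=> habc; apply/esym/eqP; rewrite -subr_eq0; apply/eqP.
pose P := [set x : E * E * E | x.1.1 [+] x.1.2 [=] x.2].
pose defect (x : E * E * E) : R := h x.1.1 + h x.1.2 - h x.2.
suff: defect (a, b, c) = 0 by [].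
apply: (@halving_eq0 _ _ P defect 2) => // -[[{habc}a {}b] {}c] /= habc.
  rewrite /defect /=.
  have := binary_value_ge0 a; have := binary_value_le1 a.
  have := binary_value_ge0 b; have := binary_value_le1 b.
  have := binary_value_ge0 c; have := binary_value_le1 c.
  by rewrite ler_norml; lra.
have cge e f : e [+] f [=] c -> digit e -> digit c.
  move=> ef /asboolPn de; apply/asboolPn => dc; apply: de.
  have ec := psum_lel ef; apply: (ea_le_trans ec).
  exact: ea_le_trans dc (compl_le ec).
have dcb := cge _ _ (psumC habc); have {cge}dca := cge _ _ habc.
have dab : ~~ (digit a && digit b).
  apply/andP => -[/asboolPn da /asboolPn db].
  have ab : a [<=] compl b by apply/psum_definedE; exists c.
  have ba : b [<=] compl a by apply/psum_definedE; exists c; exact: psumC.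
  have [le|le] := linE a b; first exact/da/(ea_le_trans le).
  exact/db/(ea_le_trans le).
(* One of the summands above 1/2: both 2 x - 1 and 2 c - 1 drop the same 1. *)
have carry1 e f : e [+] f [=] c -> digit e -> ~~ digit f -> digit c ->
    shift e [+] shift f [=] shift c.
  move=> ef de df dc; have he := shift_digit1 de; have hc := shift_digit1 dc.
  have hf := shift_digit0 df.
  have [x hx hex] := psumA ef (psum_compl c).
  rewrite (compl_unique hex) in hx.
  have [u hu hue] := psumA (psumC hx) he.
  have [v hv hvc] := psumA hue ef; rewrite (psumI hvc hc) in hv.
  have [w hw hwc] := psumAC hu hv; rewrite (psum_fun hw hf) in hwc.
  exact: psumC.
rewrite /defect /=.
rewrite [h a]binary_valueE [h b]binary_valueE [h c]binary_valueE.
case: (boolP (digit a)) (boolP (digit b)) dca dcb dab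
  => [da|da] [db|db] //= dca dcb _.
- have dc := dca isT; exists (shift a, shift b, shift c); first exact: carry1.
  by rewrite dc; apply: normr_half => /=; left; lra.
- have dc := dcb isT; exists (shift a, shift b, shift c).
    by apply: psumC; apply: carry1 => //; exact: psumC.
  by rewrite dc; apply: normr_half => /=; left; lra.
have [dc|dc] := boolP (digit c); last first.
  exists (shift a, shift b, shift c); last by apply: normr_half => /=; left; lra.
  have [x [y [h1 h2 h3]]] := psumACA habc habc (shift_digit0 dc).
  rewrite /P /=; rewrite (psum_fun h1 (shift_digit0 da)) in h3.
  by rewrite (psum_fun h2 (shift_digit0 db)) in h3.
have [ab|ba] := linE a b.
  exists (compl (shift a), shift c, shift b).
    exact: shift_carry ab (psumC habc) _ _ _.
  apply: normr_half => /=; right; have := binary_value_compl (shift a); lra.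
exists (compl (shift b), shift c, shift a); first exact: shift_carry.
apply: normr_half => /=; right; have := binary_value_compl (shift b); lra.
Qed.

Lemma linear_state : is_state h.
Proof.
by split; [exact: binary_value_ge0|exact: binary_value1|exact: binary_valueD].
Qed.

End LinearState.

(** Pull back the state of the linearly ordered quotient. *)
Lemma prime_ideal_state (R : realType) (E : effectAlgebra)
    (mvE : is_MV_effect_algebra E) (I : set E) : is_prime_ideal I ->
  exists2 h : E -> R, is_state h & forall a, I a -> h a = 0.
Proof.
move=> [Ii I1 primeI]; pose Q := quotEA mvE Ii.
have Qlin : forall X Y : Q, X [<=] Y \/ Y [<=] X by exact: quot_linear.
have Q01 : @ea0 Q <> ea1.
  by move=> /esym/(qclassP mvE Ii)/(congr_mod0 Ii).
have hs := linear_state (R := R) Qlin Q01.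
pose k := fun a => binary_value (R := R) (E := Q) (qclass I a).
have kD a b c : a [+] b [=] c -> k c = k a + k b.
  move=> abc; apply: (stateD hs); apply/(qpaddP mvE Ii).
  by exists a, b, c.
exists k; first by split=> [a||//]; [exact: state_ge0 hs _|exact: state1 hs].
move=> a Ia; rewrite /k (_ : qclass I a = ea0 :> Q); first exact: state0 hs.
by apply/(qclassP mvE Ii)/(congr_mod0 Ii).
Qed.

(** * Separation by states that preserve countably many suprema *)

Section Separation.
Context {E : effectAlgebra}.
Hypothesis sigmaE : is_sigma_MV_effect_algebra E.
Let mvE : is_MV_effect_algebra E := sigmaE.1.
Implicit Types a b c d e f x : E.

Lemma is_sup_unique (S : set E) s t :
  is_sup (@ea_le E) S s -> is_sup (@ea_le E) S t -> s = t.
Proof. by move=> [s1 s2] [t1 t2]; apply: ea_le_anti; auto. Qed.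

Lemma seq_sup_exists (u : nat -> E) : exists s, is_sup (@ea_le E) (range u) s.
Proof.
by have [] := sigmaE.2 (range u) (card_image_le u setT).
Qed.

Lemma nondecr_le (u : nat -> E) : ea_nondecr u ->
  forall m n, (m <= n)%N -> u m [<=] u n.
Proof.
move=> du m n /subnK <-; elim: (n - m)%N => [|i IH]; first exact: ea_lexx.
exact: ea_le_trans IH (du _).
Qed.

(** The multiples of [x] up to [k x] lose, when truncated, only pieces that are
    disjoint from [c]; so [k x <= 1] on [c]. *)
Definition no_overflow k x c :=
  forall j, (j < k)%N -> emeet (tdiff x (compl (omul j x))) c = ea0.

Lemma no_overflow_compl k x : no_overflow k x (compl (omul k x)).
Proof.
move=> j jk; apply: (disjoint_le mvE (ea_lexx _) _ (oplus_error mvE x (omul j x))).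
exact/compl_le/(omul_mono mvE x jk).
Qed.

(** The density step: below every [c <> 0] lies some [c' <> 0] on which
    [e - u n <= 1/k] for some [n]. Indeed [e - u n] decreases to [0], hence so
    do its truncated multiples [k (e - u n)], so one of them is not above [c],
    and [c'] is what it leaves of [c]. *)
Lemma small_remainder (u : nat -> E) e k c : ea_nondecr u ->
    is_sup (@ea_le E) (range u) e -> c <> ea0 ->
  exists c', [/\ c' [<=] c, c' <> ea0 & exists n, no_overflow k (ediff e (u n)) c'].
Proof.
move=> du [ue eu] c0; have {}ue n : u n [<=] e by apply: ue; exists n.
pose x n := ediff e (u n).
have dx n : x n.+1 [<=] x n by exact: ediff_le_anti.
have x0 : vanishing x.
  move=> w hw; have we : w [<=] e := ea_le_trans (hw 0%N) (ediff_le (ue _)).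
  have : e [<=] ediff e w.
    apply: eu => _ [n _ <-]; rewrite -(ediffK (ue n)).
    exact: (ediff_le_anti (hw n) (ediff_le (ue n))).
  move=> ew; have := ediffP we.
  rewrite -(ea_le_anti ew (ediff_le we)) => h.
  exact: psumI (psumC h) (psumr0 e).
have [n hn] : exists n, ~ (c [<=] omul k (x n)).
  apply/existsNP => h; apply: c0; exact: omul_vanishing mvE k _ dx x0 c h.
exists (tdiff c (omul k (x n))); split.
- exact: tdiff_le.
- by move/(tdiff_eq0 mvE).
exists n => j jk.
apply: (disjoint_le mvE (ea_lexx _) _ (@no_overflow_compl _ _ _ jk)).
exact: tdiff_compl.
Qed.

(** If every truncated multiple of [d] were a true one, their supremum [w]
    would satisfy [w + d <= w]. *)
Lemma omul_overflow d : d <> ea0 -> exists k, ~ (d [<=] compl (omul k d)).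
Proof.
move=> d0; apply/existsNP => h; apply: d0.
have [w [uw wu]] := seq_sup_exists (fun k => omul k d).
have hk k : omul k d [+] d [=] omul k.+1 d.
  by have := psum_oplus mvE (omul k d) d; rewrite emeet_idPl.
have dw : d [<=] w.
  by apply: uw; exists 1%N => //=; have := hk 0%N; rewrite /= psum0r => -[<-].
have ww : w [<=] ediff w d.
  apply: wu => _ [k _ <-].
  apply: psum_leI (psumC (hk k)) (ediffP dw) _; apply: uw; by exists k.+1.
have := ediffP dw; rewrite -(ea_le_anti ww (ediff_le dw)) => h2.
exact: psumI (psumC h2) (psumr0 w).
Qed.

Context {R : realType}.
Implicit Type h : E -> R.

Definition preserves_sup h (u : nat -> E) :=
  forall e, is_sup (@ea_le E) (range u) e -> h \o u @ \oo --> h e.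

Lemma state_omul h k x : is_state h ->
  (forall j, (j < k)%N -> h (tdiff x (compl (omul j x))) = 0) ->
  h (omul k x) = k%:R * h x.
Proof.
move=> hs; elim: k => [_|k IH hx] /=; first by rewrite state0// mul0r.
rewrite (stateD hs (psum_oplus mvE (omul k x) x)) IH; last first.
  by move=> j jk; apply: hx; exact: ltnW.
have := stateD hs (psum_tdiff mvE x (compl (omul k x))).
rewrite hx// addr0 => <-; rewrite -addn1 natrD; lra.
Qed.

(** A lower bound for [h x] when the truncated multiple is large; it holds
    whether or not truncation occurs. *)
Lemma state_omul_le h k x : is_state h -> h (omul k x) <= k%:R * h x.
Proof.
move=> hs; elim: k => [|k IH] /=; first by rewrite state0// mul0r.
rewrite (stateD hs (psum_oplus mvE (omul k x) x)).
have := state_le hs (emeet_lel mvE x (compl (omul k x))).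
rewrite -addn1 natrD; lra.
Qed.

Lemma descending_conditions (c0 : E) (req : nat -> E -> Prop) : c0 <> ea0 ->
    (forall i c, c <> ea0 -> exists c', [/\ c' [<=] c, c' <> ea0 & req i c']) ->
  exists s : nat -> E, [/\ s 0%N = c0, forall i, s i <> ea0,
    forall i, s i.+1 [<=] s i & forall i, req i (s i.+1)].
Proof.
move=> c00 dense.
have /choice[next nextP] (p : nat * {c : E | c <> ea0}) :
    exists c' : {c : E | c <> ea0}, sval c' [<=] sval p.2 /\ req p.1 (sval c').
  case: p => i [c cn0]; have [c' [? h ?]] := dense i c cn0.
  by exists (exist (fun c => c <> ea0) c' h).
pose fix s i := if i is i'.+1 then next (i', s i') else exist _ c0 c00.
exists (fun i => sval (s i)); split=> // i; first exact: proj2_sig (s i).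
- by have [] := nextP (i, s i).
- by have [] := nextP (i, s i).
Qed.

(** A Rasiowa-Sikorski argument. The elements disjoint from some member of a
    descending sequence of non-zero elements form a proper ideal, and the state
    of a prime ideal above it vanishes on them. The sequence starts inside
    [a - a /\ b], on a piece where finitely many copies of that difference
    exceed [1], and its later members successively force every given supremum
    to be approached within every [1 / k]. *)
Theorem state_separation (S : nat -> nat -> E) a b :
    (forall l, ea_nondecr (S l)) -> ~ (a [<=] b) ->
  exists h, [/\ is_state h, forall l, preserves_sup h (S l) & h b < h a].
Proof.
move=> dS nab; pose d := tdiff a b.
have d0 : d <> ea0 by move/(tdiff_eq0 mvE).
have [k0 hk0] := omul_overflow d0; pose y := omul k0 d.
pose c0 := tdiff d (compl y).
have c00 : c0 <> ea0 by move/(tdiff_eq0 mvE).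
pose req i c := if unpickle i is Some (l, k) then
  exists e n, is_sup (@ea_le E) (range (S l)) e /\
              no_overflow k (ediff e (S l n)) c else True.
have [|s [s0 sn0 sdec sreq]] := @descending_conditions c0 req c00.
  move=> i c cn0; rewrite /req; case: unpickle => [[l k]|].
    have [e he] := seq_sup_exists (S l).
    have [c' [h1 h2 [n h3]]] := small_remainder k (dS l) he cn0.
    by exists c'; split=> //; exists e, n.
  by exists c; split=> //; exact: ea_lexx.
have smono i j : (i <= j)%N -> s j [<=] s i.
  move=> /subnK <-; elim: (j - i)%N => [|n IH]; first exact: ea_lexx.
  exact: ea_le_trans (sdec _) IH.
pose I0 : set E := fun f => exists i, emeet f (s i) = ea0.
have I0i : is_ideal I0.
  split.
  - by exists 0%N; rewrite emeet_idPl//; exact: ea_le0x.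
  - move=> f g fg [i gi]; exists i; exact: (disjoint_le mvE fg (ea_lexx _) gi).
  - move=> f g k fgk [i fi] [j gj]; exists (maxn i j).
    apply: (disjoint_psum mvE fgk).
      exact: (disjoint_le mvE (ea_lexx _) (smono _ _ (leq_maxl i j)) fi).
    exact: (disjoint_le mvE (ea_lexx _) (smono _ _ (leq_maxr i j)) gj).
have I01 : ~ I0 ea1.
  move=> [i]; rewrite emeetC// emeet_idPl//; [exact: sn0|exact: ea_lex1].
have [I Ip I0I] := prime_ideal_above mvE I0i I01.
have [h hs hI] := prime_ideal_state R mvE Ip.
exists h; split=> //.
- move=> l e he.
  have le_e n : h (S l n) <= h e by apply: state_le => //; apply: he.1; exists n.
  have approx k : exists n, k%:R * (h e - h (S l n)) <= 1.
    have := sreq (pickle (l, k)); rewrite /req pickleK => -[e' [n [he' hn]]].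
    rewrite (is_sup_unique he' he) in hn; exists n.
    have Sne : S l n [<=] e by apply: he.1; exists n.
    have -> : h e - h (S l n) = h (ediff e (S l n)).
      by have := stateD hs (ediffP Sne); lra.
    rewrite -state_omul//; first exact: state_le1.
    by move=> j jk; apply/hI/I0I; exists (pickle (l, k)).+1; exact: hn.
  apply/cvgrPdist_lt => eps eps0.
  have [k hk] : exists k : nat, eps^-1 < k%:R.
    by exists (Num.truncn eps^-1).+1; exact: truncnS_gt.
  have [n hn] := approx k; exists n => // m /= nm.
  rewrite ger0_norm ?subr_ge0//.
  have := state_le hs (nondecr_le (dS l) nm) => hnm.
  have kgt0 : 0 < k%:R :> R by apply: lt_trans hk; rewrite invr_gt0.
  have : 1 < k%:R * eps by rewrite mulrC -ltr_pdivrMl// mulr1.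
  move=> keps; rewrite -(ltr_pM2l kgt0); apply: le_lt_trans keps.
  by apply: le_trans hn; rewrite ler_pM2l//; lra.
- have hba : h (tdiff b a) = 0.
    apply/hI/I0I; exists 0%N; rewrite s0.
    apply: (disjoint_le mvE (ea_lexx _) (tdiff_le mvE d _)).
    by rewrite emeetC//; exact: tdiff_disjoint.
  have hyd : h (tdiff (compl y) d) = 0.
    by apply/hI/I0I; exists 0%N; rewrite s0; exact: tdiff_disjoint.
  have h1 := stateD hs (psum_tdiff mvE a b).
  have := stateD hs (psum_tdiff mvE b a); rewrite emeetC// => h2.
  have h3 := stateD hs (psum_tdiff mvE (compl y) d).
  have h4 := state_le hs (emeet_ler mvE (compl y) d).
  have h5 := state_omul_le k0 d hs; rewrite -/y in h5.
  have h6 := state_compl hs y.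
  have hd : 0 < h d.
    rewrite lt_neqAle state_ge0// andbT; apply/eqP => hd0.
    by move: h5 h4; rewrite -hd0 mulr0; lra.
  rewrite h1 h2 hba -/d; lra.
Qed.

Corollary state_separation_countable (C : set (nat -> E)) a b : countable C ->
    (forall u, C u -> ea_nondecr u) -> ~ (a [<=] b) ->
  exists h, [/\ is_state h, forall u, C u -> preserves_sup h u & h b < h a].
Proof.
move=> /countable_injP[f finj] dC nab.
pose S l : nat -> E := if pselect (exists u, C u /\ f u = l) is left w
  then sval (cid w) else fun=> ea0.
have SE u : C u -> S (f u) = u.
  move=> Cu; rewrite /S; case: pselect => [w|[]]; last by exists u.
  by case: cid => v /= [Cv fv]; apply: finj; rewrite ?inE.
have [|h [hs hS hab]] := state_separation (S := S) _ nab.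
  move=> l; rewrite /S; case: pselect => [w|_ n]; last exact: ea_lexx.
  by case: cid => v /= [Cv _]; exact: dC.
by exists h; split=> // u Cu; rewrite -(SE u Cu); exact: hS.
Qed.

End Separation.

(** * Spectral families and the observables they determine *)

Section QuantileMeasure.
Context {R : realType}.
Variables (f : R -> R) (alpha beta : R).
Hypothesis f_nd : forall s t, s <= t -> f s <= f t.
Hypothesis f0 : forall t, t <= alpha -> f t = 0.
Hypothesis f1 : forall t, beta <= t -> f t = 1.

(** Including all [t <= alpha] keeps the set non-empty for every real [u], so
    that the quantile function is monotone on the whole line. *)
Let below u := [set t | t <= alpha \/ (f t <= u /\ t <= beta)].

Definition quantile u : R := sup (below u).

Let alpha_beta : alpha < beta.
Proof. by rewrite ltNge; apply/negP => /f0; rewrite f1//; lra. Qed.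

Let f01 t : 0 <= f t <= 1.
Proof.
apply/andP; split.
  by have [/f0 ->|/ltW/f_nd] := leP t alpha; rewrite ?(f0 (lexx alpha)).
by have [/f1 ->|/ltW/f_nd] := leP beta t; rewrite ?(f1 (lexx beta)).
Qed.

Let below_has_sup u : has_sup (below u).
Proof.
split; first by exists alpha; left.
exists beta => t [ta|[_ tb]] //; exact/ltW/(le_lt_trans ta).
Qed.

Lemma quantile_nd : nondecreasing_fun quantile.
Proof.
move=> u v uv; apply: le_sup.
- move=> t [ta|[tu tb]]; exists t; split=> //; first by left.
  by right; split=> //; exact: le_trans uv.
- by case: (below_has_sup u).
- exact: below_has_sup.
Qed.

Lemma quantile_lt u t : 0 <= u < 1 -> quantile u < t <-> exists2 s, s < t & u < f s.
Proof.
move=> /andP[u0 u1]; split=> [qt|[s st us]].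
  have [s /andP[qs st]] : exists s, quantile u < s < t.
    by exists ((quantile u + t) / 2); apply/andP; split; lra.
  exists s => //; rewrite ltNge; apply/negP => fs.
  have : below u s.
    right; split=> //; rewrite leNgt; apply/negP => /ltW/f1; lra.
  move=> /(ub_le_sup (below_has_sup u).2); rewrite -/(quantile u); lra.
apply: le_lt_trans st; apply: ge_sup; first exact: (below_has_sup u).1.
move=> r; rewrite leNgt => -[ra|[fr _]]; apply/negP => /ltW sr.
  by have := f0 (le_trans sr ra); lra.
by have := f_nd sr; lra.
Qed.

(** The image of Lebesgue measure on the unit interval under the quantile
    function. It gives the open ray below [t] the length of the union of the
    intervals from [0] to [f s] with [s < t], that is, the left limit of [f] at
    [t]. *)
Lemma quantile_measure : exists mu : {measure set (measurableTypeR R) -> \bar R},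
  mu setT = 1%E /\
  forall t l, f (t - n.+1%:R^-1) @[n --> \oo] --> l -> mu `]-oo, t[%classic = l%:E.
Proof.
pose T := measurableTypeR R.
have mI : measurable (`[0, 1[%classic : set T) by exact: measurable_itv.
pose lam : {measure set T -> \bar R} := mrestr lebesgue_measure mI.
have mq : measurable_fun [set: T] (quantile : T -> T).
  by apply: nondecreasing_measurable => //; exact: quantile_nd.
have [mu muE] : exists mu : {measure set T -> \bar R}, forall A,
     mu A = lam (quantile @^-1` A).
  unshelve eexists.
    exact: [the {measure set T -> \bar R} of
      pushforward lam (quantile : T -> T)].
  by [].
exists mu; split.
  rewrite muE preimage_setT /lam /= /mrestr setTI.
  by rewrite lebesgue_measure_itv /= lte01 oppr0 adde0.
move=> t l fl; rewrite muE.
pose u n := f (t - n.+1%:R^-1).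
have u01 n : 0 <= u n <= 1 by exact: f01.
rewrite /lam /= /mrestr.
have -> : quantile @^-1` `]-oo, t[ `&` `[0, 1[ = \bigcup_n `[0, u n[%classic.
  apply/seteqP; split=> v /=; rewrite !in_itv/=.
    move=> [qv v01]; have [s st vs] := (quantile_lt t v01).1 qv.
    have ts : 0 < t - s by rewrite subr_gt0.
    exists (Num.truncn (t - s)^-1) => //=; rewrite in_itv/=.
    have [-> _] := andP v01; apply: (lt_le_trans vs); apply: f_nd.
    rewrite lerBrDr -lerBrDl -[leRHS]invrK lef_pV2 ?posrE ?invr_gt0//.
    exact/ltW/truncnS_gt.
  move=> [n _] /=; rewrite in_itv/= => /andP[v0 vu].
  have v01 : 0 <= v < 1 by rewrite v0 (lt_le_trans vu)//; case/andP: (u01 n).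
  split=> //; apply/(quantile_lt _ v01); exists (t - n.+1%:R^-1) => //.
  by rewrite ltrBlDr ltrDl invr_gt0.
have und : nondecreasing_seq u.
  move=> m n mn; apply: f_nd; rewrite lerD2l lerN2 lef_pV2 ?posrE//.
  by rewrite ler_nat.
have lamE n : lebesgue_measure (`[0, u n[%classic : set R) = (u n)%:E.
  rewrite lebesgue_measure_itv /= lte_fin; case/andP: (u01 n) => un0 _.
  by case: ltgtP un0 => // [_ _|<-//]; rewrite oppr0 adde0.
have h : (lebesgue_measure \o (fun n => `[0, u n[%classic : set R)) @ \oo -->
    lebesgue_measure (\bigcup_n `[0, u n[%classic : set R).
  apply: nondecreasing_cvg_mu.
  - by move=> n; exact: measurable_itv.
  - by apply: bigcup_measurable => n _; exact: measurable_itv.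
  - move=> m n mn; apply/subsetPset => v /=; rewrite !in_itv/= => /andP[-> vu].
    exact: lt_le_trans vu (und _ _ mn).
apply: cvg_unique h _ => //.
rewrite (_ : _ \o _ = fun n => (u n)%:E); last by apply/funext => n; exact: lamE.
by apply: cvg_EFin => //; exact: nearW.
Qed.

End QuantileMeasure.

Lemma countable_setU (T : Type) (A B : set T) :
  countable A -> countable B -> countable (A `|` B).
Proof.
move=> cA cB; rewrite -bigcup2E; apply: bigcup_countable => //.
by move=> [|[|i]] _ //=; exact: countable0.
Qed.

Section SpectralFamily.
Context {R : realType} {E : effectAlgebra}.
Hypothesis sigmaE : is_sigma_MV_effect_algebra E.
Let mvE : is_MV_effect_algebra E := sigmaE.1.
Implicit Types (F : R -> E) (A B : set R) (a b e : E) (s t : R) (h : E -> R).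

Definition left_approx F t (n : nat) : E := F (t - n.+1%:R^-1).

(** Left continuity is asked along one sequence only: [F] is increasing. *)
Record is_spectral_family F : Prop := {
  spectral_mono : forall s t, s <= t -> F s [<=] F t;
  spectral_left : forall t, is_sup (@ea_le E) (range (left_approx F t)) (F t);
  spectral_low : exists alpha, forall t, t <= alpha -> F t = ea0;
  spectral_high : exists beta, forall t, beta <= t -> F t = ea1 }.

Lemma left_approx_nondecr F t : is_spectral_family F ->
  ea_nondecr (left_approx F t).
Proof.
move=> Fs n; apply: (spectral_mono Fs).
by rewrite lerD2l lerN2 lef_pV2 ?posrE// ler_nat.
Qed.

Lemma spectral_measure F h : is_spectral_family F -> is_state h ->
  exists mu : {measure set (measurableTypeR R) -> \bar R},
    mu setT = 1%E /\ forall t, preserves_sup h (left_approx F t) ->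
      mu `]-oo, t[%classic = (h (F t))%:E.
Proof.
move=> Fs hs; have [alpha Fa] := spectral_low Fs.
have [beta Fb] := spectral_high Fs.
have [|t ta|t tb|mu [mu1 mut]] := @quantile_measure R (h \o F) alpha beta.
- by move=> s t st; apply: (state_le hs); exact: spectral_mono Fs _ _ st.
- by rewrite /= Fa// state0.
- by rewrite /= Fb// state1.
exists mu; split=> // t ht; apply: mut; exact: ht _ (spectral_left Fs t).
Qed.

Section Extension.
Variables (F : R -> E)
  (mu : (E -> R) -> {measure set (measurableTypeR R) -> \bar R}).
Hypothesis Fs : is_spectral_family F.
Hypothesis mu_setT : forall h, is_state h -> mu h setT = 1%E.
Hypothesis mu_ray : forall h t, is_state h ->
  preserves_sup h (left_approx F t) -> mu h `]-oo, t[%classic = (h (F t))%:E.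

(** [e] is the only possible value of the observable at [A]: every state that
    preserves a suitable countable family of suprema gives [e] the mass of [A]
    under the distribution that this state assigns to [F]. *)
Definition determined A e := exists C : set (nat -> E),
  [/\ countable C, forall u, C u -> ea_nondecr u &
    forall h, is_state h -> (forall u, C u -> preserves_sup h u) ->
      mu h A = (h e)%:E].

(** Otherwise some state preserving both families of suprema has
    [h b < h a = mu h A <= mu h B = h b]. *)
Lemma determined_le A B a b : measurable A -> measurable B -> A `<=` B ->
  determined A a -> determined B b -> a [<=] b.
Proof.
move=> mA mB AB [C [cC dC hC]] [C' [cC' dC' hC']]; apply: contrapT => nab.
have dCC' u : (C `|` C') u -> ea_nondecr u by move=> [/dC|/dC'].
have [h [hs hCC' hba]] := state_separation_countable (R := R) sigmaE
  (countable_setU cC cC') dCC' nab.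
have : (mu h A <= mu h B)%E by apply: le_measure; rewrite ?inE.
rewrite hC// => [|u Cu]; last by apply: hCC'; left.
rewrite hC'// => [|u Cu]; last by apply: hCC'; right.
by rewrite lee_fin leNgt hba.
Qed.

Lemma determined_fun A a b : measurable A ->
  determined A a -> determined A b -> a = b.
Proof.
move=> mA Aa Ab; apply: ea_le_anti.
  exact: (determined_le mA mA (@subset_refl _ A) Aa Ab).
exact: (determined_le mA mA (@subset_refl _ A) Ab Aa).
Qed.

Lemma determinedT : determined setT ea1.
Proof.
by exists set0; split=> // h hs _; rewrite mu_setT// state1.
Qed.

Lemma determined_ray t : determined `]-oo, t[%classic (F t).
Proof.
exists [set left_approx F t]; split=> [|_ ->|h hs hC].
- exact: countable1.
- exact: left_approx_nondecr.
- by apply: mu_ray => //; exact: hC.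
Qed.

Lemma determinedU A B a b : measurable A -> measurable B -> A `&` B = set0 ->
    determined A a -> determined B b ->
  forall c, a [+] b [=] c -> determined (A `|` B) c.
Proof.
move=> mA mB AB [C [cC dC hC]] [C' [cC' dC' hC']] c abc.
exists (C `|` C'); split.
- exact: countable_setU.
- by move=> u [/dC|/dC'].
move=> h hs hCC'; rewrite measureU// (stateD hs abc) EFinD.
congr (_ + _)%E; first by apply: hC => // u Cu; apply: hCC'; left.
by apply: hC' => // u Cu; apply: hCC'; right.
Qed.

Lemma determinedD A B a b : measurable A -> measurable B -> B `<=` A ->
    determined A a -> determined B b -> determined (A `\` B) (ediff a b).
Proof.
move=> mA mB BA Aa Bb; have ba := determined_le mB mA BA Bb Aa.
have [C [cC dC hC]] := Aa; have [C' [cC' dC' hC']] := Bb.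
exists (C `|` C'); split.
- exact: countable_setU.
- by move=> u [/dC|/dC'].
move=> h hs hCC'.
have muA : mu h A = (h a)%:E by apply: hC => // u Cu; apply: hCC'; left.
have muB : mu h B = (h b)%:E by apply: hC' => // u Cu; apply: hCC'; right.
have hab : h (ediff a b) = h a - h b by have := stateD hs (ediffP ba); lra.
rewrite measureD//; last first.
  by apply: (@le_lt_trans _ _ (h a)%:E); [rewrite -muA|rewrite ltry].
rewrite setIidr// hab.
by rewrite EFinB; congr (_ - _)%E.
Qed.

(** Adding the sequence of values itself to the families of suprema makes the
    states pass to the limit. *)
Lemma determined_bigcup (A : nat -> set R) (e : nat -> E) (s : E) :
    (forall i, measurable (A i)) -> nondecreasing_seq A ->
    (forall i, determined (A i) (e i)) -> is_sup (@ea_le E) (range e) s ->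
  determined (\bigcup_i A i) s.
Proof.
move=> mA ndA Ae es; have /choice[C hC] := Ae.
have de : ea_nondecr e.
  move=> i; apply: determined_le (mA i) (mA i.+1) _ (Ae i) (Ae i.+1).
  exact/subsetPset/ndA/leqnSn.
exists ([set e] `|` \bigcup_i C i); split.
- apply: countable_setU; first exact: countable1.
  by apply: bigcup_countable => // i _; have [] := hC i.
- by move=> u [->//|[i _]]; have [_ dC _] := hC i; exact: dC.
move=> h hs hp.
have muA i : mu h (A i) = (h (e i))%:E.
  have [_ _] := hC i; apply=> // u Cu; apply: hp; right; by exists i.
have cv : (mu h \o A) @ \oo --> mu h (\bigcup_i A i).
  by apply: nondecreasing_cvg_mu => //; exact: bigcupT_measurable.
apply: cvg_unique cv _ => //.
rewrite (_ : _ \o _ = fun i => (h (e i))%:E); last by apply/funext => i; exact: muA.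
by apply: cvg_EFin; [exact: nearW|apply: (hp e) => //; left].
Qed.

Lemma determined_exists A : measurable A -> exists e, determined A e.
Proof.
move=> mA; pose H := [set A : set R | measurable A /\ exists e, determined A e].
suff : H A by case.
have GI : setI_closed (@RGenInftyO.G R).
  move=> _ _ [s ->] [t ->]; exists (Num.min s t); apply/seteqP.
  by split=> r /=; rewrite !in_itv/= lt_min; [move=> [-> ->]|move/andP].
have HL : lambda_system setT H.
  split=> //.
  - by split; [exact: measurableT|exists ea1; exact: determinedT].
  - move=> B B' BB [mB [b hb]] [mB' [b' hb']]; split; first exact: measurableD.
    by exists (ediff b b'); exact: determinedD.
  - move=> B ndB HB; split; first by apply: bigcupT_measurable => i; case: (HB i).
    have /choice[e he] i : exists e, determined (B i) e by case: (HB i).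
    have [s hs] := seq_sup_exists sigmaE e.
    exists s; apply: determined_bigcup ndB he hs => i; by case: (HB i).
have GH : @RGenInftyO.G R `<=` H.
  move=> _ [t ->]; split; first exact: measurable_itv.
  by exists (F t); exact: determined_ray.
apply: (lambda_system_subset GI HL GH) => //.
by move: mA; rewrite [X in X A]RGenInftyO.measurableE.
Qed.

Definition extension (A : borel R) : E :=
  sval (cid (determined_exists (borel_measurable A))).

Lemma extensionE (A : borel R) e : determined A e -> extension A = e.
Proof.
rewrite /extension; case: cid => a /= Aa Ae.
exact: determined_fun (borel_measurable A) Aa Ae.
Qed.

Lemma extensionP (A : borel R) : determined A (extension A).
Proof. by rewrite /extension; case: cid. Qed.

Lemma extension_observable : is_observable extension.
Proof.
split.
- exact/extensionE/determinedT.
- move=> A B AB; have mA := borel_measurable A; have mB := borel_measurable B.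
  have [c abc] : exists c, extension A [+] extension B [=] c.
    apply/psum_definedE.
    have hBc : determined (~` B) (compl (extension B)).
      rewrite -setTD -(ediffE (psum_compl _)).
      by apply: determinedD => //; [exact: determinedT|exact: extensionP].
    apply: determined_le mA (measurableC mB) _ (extensionP A) hBc.
    by apply/disjoints_subset.
  rewrite abc; congr Some; apply/esym/extensionE => /=.
  exact: determinedU AB (extensionP A) (extensionP B) _ abc.
- move=> A ndA; have [s hs] := seq_sup_exists sigmaE (fun i => extension (A i)).
  have ndA' : nondecreasing_seq (fun i => A i : set R).
    by apply/nondecreasing_seqP => i; exact/subsetPset/ndA.
  rewrite (_ : extension _ = s)//; apply: extensionE => /=.
  apply: (determined_bigcup _ ndA' _ hs) => i; first exact: borel_measurable.
  exact: extensionP.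
Qed.

End Extension.
End SpectralFamily.

(** * Observables and their spectral resolutions *)

Section Observables.
Context {R : realType} {E : effectAlgebra}.
Implicit Types (A B C : borel R) (s t : R).

Lemma borel_ext A B : A = B :> set R -> A = B.
Proof.
case: A B => [A mA] [B mB] /= AB; rewrite AB in mA *.
by congr Borel; exact: Prop_irrelevance.
Qed.

Section OneObservable.
Variable x : borel R -> E.
Hypothesis xobs : is_observable x.

Lemma observable_psum A B C : A `&` B = set0 -> A `|` B = C ->
  x A [+] x B [=] x C.
Proof.
move=> AB ABC; rewrite (observableU xobs AB); congr (Some (x _)).
exact: borel_ext.
Qed.

Lemma observable_le A B : A `<=` B -> x A [<=] x B.
Proof.
move=> AB.
exists (x (Borel (measurableD (borel_measurable B) (borel_measurable A)))).
by apply: observable_psum; rewrite /= ?setDIK// setDUK.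
Qed.

Lemma observable_sup (A : nat -> borel R) B : (forall i, A i `<=` A i.+1) ->
  \bigcup_i A i = B -> is_sup (@ea_le E) (range (fun i => x (A i))) (x B).
Proof.
move=> ndA AB; have := observable_bigcup xobs ndA.
by rewrite (borel_ext (A := Borel _) (B := B)).
Qed.

Lemma spectral_resolution_le s t : s <= t ->
  spectral_resolution x s [<=] spectral_resolution x t.
Proof.
move=> st; apply: observable_le => r /=; rewrite !in_itv/= => rs.
exact: lt_le_trans rs st.
Qed.

Lemma spectral_resolution_left t :
  is_sup (@ea_le E) (range (left_approx (spectral_resolution x) t))
    (spectral_resolution x t).
Proof.
apply: (observable_sup (A := fun n => borel_itv `]-oo, t - n.+1%:R^-1[)).
  move=> n r /=; rewrite !in_itv/= => /lt_le_trans; apply.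
  by rewrite lerD2l lerN2 lef_pV2 ?posrE// ler_nat.
apply/seteqP; split=> r /=.
  move=> [n _] /=; rewrite !in_itv/= => /lt_le_trans; apply.
  by rewrite gerBl invr_ge0.
rewrite in_itv/= -subr_gt0 => rt; exists (Num.truncn (t - r)^-1) => //=.
rewrite in_itv/= ltrBrDr -ltrBrDl -[ltRHS]invrK ltf_pV2 ?posrE ?invr_gt0//.
exact: truncnS_gt.
Qed.

End OneObservable.

Lemma spectral_resolution_family (x : boundedObservable R E) :
  is_spectral_family (spectral_resolution x).
Proof.
case: x => x xo [alpha [beta x1]] /=; split.
- exact: spectral_resolution_le.
- exact: spectral_resolution_left.
- exists alpha => t ta; apply: padd_ea1; rewrite -x1 (observableU xo)//.
  apply/disjoints_subset => r /=; rewrite !in_itv/= => rt.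
  move=> /andP[ar _]; move: (lt_le_trans rt ta); by rewrite ltNge ar.
- exists (beta + 1) => t tb; apply: ea_le_anti (ea_lex1 _) _; rewrite -x1.
  apply: observable_le => // r /=; rewrite !in_itv/= => /andP[_ rb].
  by apply: (le_lt_trans rb); apply: lt_le_trans tb; rewrite ltrDl.
Qed.

(** The rays form a pi-system generating the Borel sets, and the sets on which
    two observables agree form a lambda-system. *)
Lemma spectral_resolution_inj (x y : boundedObservable R E) :
  (forall t, spectral_resolution x t = spectral_resolution y t) -> x = y.
Proof.
case: x y => [x xo xb] [y yo yb]; rewrite /spectral_resolution /= => xy.
suff xy1 : x = y.
  rewrite xy1 in xo xb *; congr BoundedObservable; exact: Prop_irrelevance.
pose H := [set A : set R | measurable A /\
  forall mA : measurable A, x (Borel mA) = y (Borel mA)].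
suff HA : forall A : set R, measurable A -> H A.
  by apply/funext => -[A mA]; have [_ h] := HA A mA; exact: h.
have GI : setI_closed (@RGenInftyO.G R).
  move=> _ _ [s ->] [t ->]; exists (Num.min s t); apply/seteqP.
  by split=> r /=; rewrite !in_itv/= lt_min; [move=> [-> ->]|move/andP].
have GH : @RGenInftyO.G R `<=` H.
  move=> _ [t ->]; split=> [|mt]; first exact: measurable_itv.
  by rewrite (borel_ext (A := Borel mt) (B := borel_itv `]-oo, t[))//; exact: xy.
have HL : lambda_system setT H.
  split=> //.
  - split=> [|mT]; first exact: measurableT.
    rewrite (borel_ext (A := Borel mT) (B := Borel measurableT))//.
    by rewrite (observableT xo) (observableT yo).
  - move=> A B BA [mA hA] [mB hB]; split=> [|mAB]; first exact: measurableD.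
    have D0 : B `&` (A `\` B) = set0 by rewrite setDIK.
    have D1 : B `|` (A `\` B) = A by rewrite setDUK.
    have hx := observable_psum xo (A := Borel mB) (B := Borel mAB)
      (C := Borel mA) D0 D1.
    have := observable_psum yo (A := Borel mB) (B := Borel mAB)
      (C := Borel mA) D0 D1.
    by rewrite -hA -hB => hy; exact: psumI hx hy.
  - move=> A ndA HA.
    have mA i : measurable (A i) by have [] := HA i.
    split=> [|mU]; first exact: bigcupT_measurable.
    have ndA' i : Borel (mA i) `<=` Borel (mA i.+1) by exact/subsetPset/ndA/leqnSn.
    have hx := observable_sup xo (A := fun i => Borel (mA i))
      (B := Borel mU) ndA' erefl.
    have hy := observable_sup yo (A := fun i => Borel (mA i))
      (B := Borel mU) ndA' erefl.
    have e : (fun i => x (Borel (mA i))) = (fun i => y (Borel (mA i))).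
      by apply/funext => i; exact: (HA i).2.
    by rewrite e in hx; exact: is_sup_unique hx hy.
move=> A mA; apply: (lambda_system_subset GI HL GH) => //.
by move: mA; rewrite [X in X A]RGenInftyO.measurableE.
Qed.

Hypothesis sigmaE : is_sigma_MV_effect_algebra E.

Theorem spectral_family_observable (F : R -> E) : is_spectral_family F ->
  exists x : boundedObservable R E, spectral_resolution x = F.
Proof.
move=> Fs.
have /choice[mu muP] (h : E -> R) :
    exists mu : {measure set (measurableTypeR R) -> \bar R}, is_state h ->
    mu setT = 1%E /\ forall t, preserves_sup h (left_approx F t) ->
      mu `]-oo, t[%classic = (h (F t))%:E.
  have [hs|nhs] := pselect (is_state h); last by exists lebesgue_measure.
  by have [mu hmu] := spectral_measure Fs hs; exists mu.
have mu1 h (hs : is_state h) := (muP h hs).1.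
have mut h t (hs : is_state h) := (muP h hs).2 t.
pose x := extension sigmaE Fs mu1 mut.
have xo : is_observable x by exact: extension_observable.
have xF t : spectral_resolution x t = F t.
  by apply: extensionE; exact: determined_ray.
have xb : is_bounded x.
  have [alpha Fa] := spectral_low Fs; have [beta Fb] := spectral_high Fs.
  pose beta' := Num.max alpha beta; exists alpha, beta'.
  have h := observable_psum xo (A := borel_itv `]-oo, alpha[)
    (B := borel_itv `[alpha, beta'[) (C := borel_itv `]-oo, beta'[).
  have {h} : x (borel_itv `]-oo, alpha[) [+] x (borel_itv `[alpha, beta'[) [=]
      x (borel_itv `]-oo, beta'[).
    apply: h; apply/seteqP; split=> r //=; rewrite !in_itv/=.
    - by move=> [ra /andP[]]; rewrite leNgt ra.
    - move=> [ra|/andP[]//]; apply: lt_le_trans ra _.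
      by rewrite le_max lexx.
    - by move=> rb; have [ra|ra] := ltP r alpha; [left|right; apply/andP].
  have := xF alpha; rewrite /spectral_resolution Fa// => ->.
  have := xF beta'; rewrite /spectral_resolution Fb ?le_max ?lexx ?orbT// => ->.
  rewrite psum0r => -[h1]; apply: ea_le_anti (ea_lex1 _) _; rewrite -h1.
  apply: observable_le => // r /=; rewrite !in_itv/= => /andP[->].
  exact: ltW.
exists (BoundedObservable xo xb); apply/funext => t; exact: xF.
Qed.

End Observables.

(** * The Olson order and the sum of bounded observables *)

Section SpectralOperations.
Context {R : realType} {E : effectAlgebra}.
Hypothesis sigmaE : is_sigma_MV_effect_algebra E.
Let mvE : is_MV_effect_algebra E := sigmaE.1.
Implicit Types (F G K : R -> E) (a b c w : E) (s t : R) (p q r : rat).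

Lemma ejoin_distr a b c :
  ejoin (emeet a b) c = emeet (ejoin a c) (ejoin b c).
Proof.
apply: ea_le_anti.
  apply: (ejoin_lub mvE); apply: (emeet_glb mvE); try exact: ejoin_ger.
    exact: ea_le_trans (emeet_lel mvE _ _) (ejoin_gel mvE _ _).
  exact: ea_le_trans (emeet_ler mvE _ _) (ejoin_gel mvE _ _).
apply: (emeet_sup mvE (ejoinP mvE a c)) => _ [->|->]; last first.
  exact: ea_le_trans (emeet_lel mvE _ _) (ejoin_ger mvE _ _).
rewrite emeetC//; apply: (emeet_sup mvE (ejoinP mvE b c)) => _ [->|->].
  by rewrite emeetC//; exact: ejoin_gel.
exact: ea_le_trans (emeet_lel mvE _ _) (ejoin_ger mvE _ _).
Qed.

Lemma left_approx_le F t n : is_spectral_family F -> left_approx F t n [<=] F t.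
Proof. by move=> Fs; apply: (spectral_left Fs t).1; exists n. Qed.

Lemma emeet_spectral_family F G : is_spectral_family F -> is_spectral_family G ->
  is_spectral_family (fun t => emeet (F t) (G t)).
Proof.
move=> Fs Gs; split.
- move=> s t st; apply: (emeet_le mvE); first exact: spectral_mono Fs _ _ st.
  exact: spectral_mono Gs _ _ st.
- move=> t; split=> [_ [n _ <-]|w hw].
    by apply: (emeet_le mvE); exact: left_approx_le.
  apply: (emeet_sup mvE (spectral_left Fs t)) => _ [m _ <-].
  rewrite emeetC//; apply: (emeet_sup mvE (spectral_left Gs t)) => _ [n _ <-].
  rewrite emeetC//; apply: ea_le_trans (hw _ (ex_intro2 _ _ (maxn m n) I erefl)).
  apply: (emeet_le mvE).
    exact: nondecr_le (left_approx_nondecr t Fs) _ _ (leq_maxl m n).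
  exact: nondecr_le (left_approx_nondecr t Gs) _ _ (leq_maxr m n).
- have [alpha Fa] := spectral_low Fs; exists alpha => t ta.
  by apply: ea_lex0; rewrite -(Fa t ta); exact: emeet_lel.
- have [beta Fb] := spectral_high Fs; have [beta' Gb] := spectral_high Gs.
  exists (Num.max beta beta') => t; rewrite ge_max => /andP[tb tb'].
  by rewrite Fb// Gb// emeet_idPl//; exact: ea_lexx.
Qed.

Lemma ejoin_spectral_family F G : is_spectral_family F -> is_spectral_family G ->
  is_spectral_family (fun t => ejoin (F t) (G t)).
Proof.
move=> Fs Gs; split.
- move=> s t st; apply: (ejoin_le mvE); first exact: spectral_mono Fs _ _ st.
  exact: spectral_mono Gs _ _ st.
- move=> t; split=> [_ [n _ <-]|w hw].
    by apply: (ejoin_le mvE); exact: left_approx_le.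
  apply: (ejoin_lub mvE).
    apply: (spectral_left Fs t).2 => _ [n _ <-].
    exact: ea_le_trans (ejoin_gel mvE _ _) (hw _ (ex_intro2 _ _ n I erefl)).
  apply: (spectral_left Gs t).2 => _ [n _ <-].
  exact: ea_le_trans (ejoin_ger mvE _ _) (hw _ (ex_intro2 _ _ n I erefl)).
- have [alpha Fa] := spectral_low Fs; have [alpha' Ga] := spectral_low Gs.
  exists (Num.min alpha alpha') => t; rewrite le_min => /andP[ta ta'].
  rewrite Fa// Ga//; apply: ea_lex0.
  by apply: (ejoin_lub mvE); exact: ea_lexx.
- have [beta Fb] := spectral_high Fs; exists beta => t tb.
  by apply: ea_le_anti (ea_lex1 _) _; rewrite -(Fb t tb); exact: ejoin_gel.
Qed.

Definition convolution_term F G t r : E := emeet (F (ratr r)) (G (t - ratr r)).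

Lemma convolution_sup_exists F G t :
  exists a, is_sup (@ea_le E) (range (convolution_term F G t)) a.
Proof.
have cF := card_le_trans (card_image_le (convolution_term F G t) setT)
  (countableP _).
by have [] := sigmaE.2 _ cF.
Qed.

Definition convolution F G t : E := sval (cid (convolution_sup_exists F G t)).

Lemma convolutionP F G t :
  is_sup (@ea_le E) (range (convolution_term F G t)) (convolution F G t).
Proof. by rewrite /convolution; case: cid. Qed.

Lemma convolution_ge F G t r : convolution_term F G t r [<=] convolution F G t.
Proof. by apply: (convolutionP F G t).1; exists r. Qed.

Lemma convolution_lub F G t w :
  (forall r, convolution_term F G t r [<=] w) -> convolution F G t [<=] w.
Proof. by move=> h; apply: (convolutionP F G t).2 => _ [r _ <-]. Qed.

Lemma emeet_convolution_lub F G t a w :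
    (forall r, emeet (convolution_term F G t r) a [<=] w) ->
  emeet (convolution F G t) a [<=] w.
Proof.
move=> h; apply: (emeet_sup mvE (convolutionP F G t)) => _ [r _ <-]; exact: h.
Qed.

Lemma convolution_le F F' G t : (forall s, F s [<=] F' s) ->
  convolution F G t [<=] convolution F' G t.
Proof.
move=> FF; apply: convolution_lub => r; apply: ea_le_trans (convolution_ge _ _ _ r).
exact: (emeet_le mvE (FF _) (ea_lexx _)).
Qed.

(** Both sides are the supremum of [F p /\ G q /\ K (t - p - q)] over rational
    [p] and [q]. *)
Lemma convolutionA F G K t :
  convolution F (convolution G K) t = convolution (convolution F G) K t.
Proof.
apply: ea_le_anti; apply: convolution_lub => p.
  rewrite /convolution_term emeetC//; apply: emeet_convolution_lub => q.
  apply: ea_le_trans (convolution_ge _ _ _ (p + q)).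
  have pqE : t - ratr (p + q) = t - ratr p - ratr q.
    by rewrite raddfD/= opprD addrA.
  apply: (emeet_glb mvE); last first.
    rewrite pqE; exact: ea_le_trans (emeet_lel mvE _ _) (emeet_ler mvE _ _).
  apply: ea_le_trans (convolution_ge _ _ _ p); apply: (emeet_glb mvE).
    exact: emeet_ler.
  rewrite raddfD/= addrAC subrr add0r.
  exact: ea_le_trans (emeet_lel mvE _ _) (emeet_lel mvE _ _).
rewrite /convolution_term; apply: emeet_convolution_lub => q.
apply: ea_le_trans (convolution_ge _ _ _ q).
apply: (emeet_glb mvE).
  exact: ea_le_trans (emeet_lel mvE _ _) (emeet_lel mvE _ _).
apply: ea_le_trans (convolution_ge _ _ _ (p - q)); apply: (emeet_glb mvE).
  rewrite raddfB/=; exact: ea_le_trans (emeet_lel mvE _ _) (emeet_ler mvE _ _).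
have -> : t - ratr q - ratr (p - q) = t - ratr p :> R.
  by rewrite raddfB/=; lra.
exact: emeet_ler.
Qed.

(** On the right the two indices [p] and [q] can be replaced by the larger one,
    because [F] and [G] increase while [K (t - p) /\ K (t - q)] is below both. *)
Lemma convolution_emeet F G K t : is_spectral_family F -> is_spectral_family G ->
  convolution (fun s => emeet (F s) (G s)) K t =
  emeet (convolution F K t) (convolution G K t).
Proof.
move=> Fs Gs; apply: ea_le_anti.
  by apply: (emeet_glb mvE); apply: convolution_le => s;
    [exact: emeet_lel|exact: emeet_ler].
apply: emeet_convolution_lub => p; rewrite emeetC//.
apply: emeet_convolution_lub => q.
rewrite /convolution_term; set w := emeet _ _.
have wG : w [<=] G (ratr q) := ea_le_trans (emeet_lel mvE _ _) (emeet_lel mvE _ _).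
have wKq : w [<=] K (t - ratr q) :=
  ea_le_trans (emeet_lel mvE _ _) (emeet_ler mvE _ _).
have wF : w [<=] F (ratr p) := ea_le_trans (emeet_ler mvE _ _) (emeet_lel mvE _ _).
have wKp : w [<=] K (t - ratr p) :=
  ea_le_trans (emeet_ler mvE _ _) (emeet_ler mvE _ _).
have [pq|/ltW qp] := leP p q.
  apply: ea_le_trans (convolution_ge _ _ _ q).
  apply: (emeet_glb mvE _ wKq); apply: (emeet_glb mvE _ wG).
  by apply: (ea_le_trans wF); apply: (spectral_mono Fs); rewrite ler_rat.
apply: ea_le_trans (convolution_ge _ _ _ p).
apply: (emeet_glb mvE _ wKp); apply: (emeet_glb mvE wF).
by apply: (ea_le_trans wG); apply: (spectral_mono Gs); rewrite ler_rat.
Qed.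

Lemma convolution_spectral_family F G :
  is_spectral_family F -> is_spectral_family G ->
  is_spectral_family (convolution F G).
Proof.
move=> Fs Gs.
have mono s t : s <= t -> convolution F G s [<=] convolution F G t.
  move=> st; apply: convolution_lub => r.
  apply: ea_le_trans (convolution_ge _ _ _ r); apply: (emeet_le mvE (ea_lexx _)).
  by apply: (spectral_mono Gs); rewrite lerD2r.
split=> //.
- move=> t; split=> [_ [n _ <-]|w hw].
    by apply: mono; rewrite gerBl invr_ge0.
  apply: convolution_lub => r; rewrite /convolution_term emeetC//.
  apply: (emeet_sup mvE (spectral_left Gs _)) => _ [n _ <-].
  apply: ea_le_trans (hw _ (ex_intro2 _ _ n I erefl)).
  apply: ea_le_trans (convolution_ge _ _ _ r).
  by rewrite /convolution_term emeetC// /left_approx addrAC; exact: ea_lexx.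
- have [alpha Fa] := spectral_low Fs; have [alpha' Ga] := spectral_low Gs.
  exists (alpha + alpha') => t ta; apply/ea_lex0/convolution_lub => r.
  have [ra|ra] := leP (ratr r) alpha.
    by rewrite -(Fa _ ra); exact: emeet_lel.
  have tr : t - ratr r <= alpha' by lra.
  by rewrite -(Ga _ tr); exact: emeet_ler.
- have [beta Fb] := spectral_high Fs; have [beta' Gb] := spectral_high Gs.
  exists (beta + 1 + beta') => t tb; apply: ea_le_anti (ea_lex1 _) _.
  have [r] := @rat_in_itvoo R beta (beta + 1) ltac:(lra).
  rewrite in_itv/= => /andP[br rb].
  apply: ea_le_trans (convolution_ge F G t r).
  rewrite /convolution_term Fb ?ltW// Gb; last by lra.
  by rewrite emeet_idPl//; exact: ea_lexx.
Qed.

End SpectralOperations.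

Section OlsonLattice.
Context {R : realType} {E : effectAlgebra}.
Hypothesis sigmaE : is_sigma_MV_effect_algebra E.
Let mvE : is_MV_effect_algebra E := sigmaE.1.
Local Notation BO := (boundedObservable R E).
Local Notation B := spectral_resolution.
Implicit Types x y z : BO.

Lemma observable_with F : is_spectral_family F -> {x : BO | B x = F}.
Proof. by move=> Fs; apply: cid; exact: spectral_family_observable. Qed.

Definition olson_join x y : BO := sval (observable_with
  (emeet_spectral_family sigmaE (spectral_resolution_family x)
    (spectral_resolution_family y))).

Definition olson_meet x y : BO := sval (observable_with
  (ejoin_spectral_family sigmaE (spectral_resolution_family x)
    (spectral_resolution_family y))).

Definition observable_add x y : BO := sval (observable_with
  (convolution_spectral_family sigmaE (spectral_resolution_family x)
    (spectral_resolution_family y))).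

Lemma olson_joinE x y t : B (olson_join x y) t = emeet (B x t) (B y t).
Proof. by rewrite /olson_join; case: observable_with => z /= ->. Qed.

Lemma olson_meetE x y t : B (olson_meet x y) t = ejoin (B x t) (B y t).
Proof. by rewrite /olson_meet; case: observable_with => z /= ->. Qed.

Lemma observable_addE x y t :
  B (observable_add x y) t = convolution sigmaE (B x) (B y) t.
Proof. by rewrite /observable_add; case: observable_with => z /= ->. Qed.

Lemma olson_le_order : Relation_Definitions.order BO (@olson_le R E).
Proof.
split=> [x t|x y z xy yz t|x y xy yx].
- exact: ea_lexx.
- exact: ea_le_trans (yz t) (xy t).
- by apply: spectral_resolution_inj => t; exact: ea_le_anti (yx t) (xy t).
Qed.

Lemma olson_lattice : lattice_with (@olson_le R E) olson_join olson_meet.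
Proof.
split=> [|x y|x y]; first exact: olson_le_order.
- split=> [_ [->|->] t|z hz t]; rewrite olson_joinE.
  + exact: emeet_lel.
  + exact: emeet_ler.
  + by apply: (emeet_glb mvE); apply: hz; [left|right].
- split=> [_ [->|->] t|z hz t]; rewrite olson_meetE.
  + exact: ejoin_gel.
  + exact: ejoin_ger.
  + by apply: (ejoin_lub mvE); apply: hz; [left|right].
Qed.

Lemma olson_meet_joinl : left_distributive olson_meet olson_join.
Proof.
move=> x y z; apply: spectral_resolution_inj => t.
by rewrite olson_meetE !olson_joinE !olson_meetE; exact: ejoin_distr.
Qed.

Lemma observable_addA : associative observable_add.
Proof.
move=> x y z; apply: spectral_resolution_inj => t; rewrite !observable_addE.
have e u v : B (observable_add u v) = convolution sigmaE (B u) (B v).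
  by apply/funext => s; exact: observable_addE.
by rewrite !e; exact: convolutionA.
Qed.

Lemma observable_add_joinl : left_distributive observable_add olson_join.
Proof.
move=> x y z; apply: spectral_resolution_inj => t.
rewrite olson_joinE !observable_addE.
have -> : B (olson_join x y) = fun s => emeet (B x s) (B y s).
  by apply/funext => s; exact: olson_joinE.
by apply: convolution_emeet; exact: spectral_resolution_family.
Qed.

Lemma observable_add_le x y z :
  olson_le x y -> olson_le (observable_add x z) (observable_add y z).
Proof. by move=> xy t; rewrite !observable_addE; exact: convolution_le. Qed.

Lemma observable_addP x y : unique (is_observable_sum x y) (observable_add x y).
Proof.
split=> [t|z hz].
  exists (convolution_term (B x) (B y) t) => [r|]; first exact: emeetP.
  by rewrite observable_addE; exact: convolutionP.
apply: spectral_resolution_inj => t; rewrite observable_addE.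
have [m hm hsup] := hz t.
have mE : m = convolution_term (B x) (B y) t.
  apply/funext => r; have [h1 h2] := hm r.
  have [h3 h4] := emeetP mvE (B x (ratr r)) (B y (t - ratr r)).
  by apply: ea_le_anti; [exact: h4|exact: h2].
rewrite mE in hsup; exact: is_sup_unique (convolutionP _ _ _ _) hsup.
Qed.

End OlsonLattice.

Theorem theorem4p4 (R : realType) (E : effectAlgebra)
    (sigmaMV_E : is_sigma_MV_effect_algebra E) :
  is_distributive_lattice (@olson_le R E) /\
  exists add : boundedObservable R E -> boundedObservable R E ->
               boundedObservable R E,
    (forall x y, unique (is_observable_sum x y) (add x y)) /\
    is_lattice_ordered_semigroup add (@olson_le R E).
Proof.
split.
  exists (olson_join sigmaMV_E), (olson_meet sigmaMV_E); split.
    exact: olson_lattice.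
  exact: olson_meet_joinl.
exists (observable_add sigmaMV_E); split; first exact: observable_addP.
split.
  split; [exact: observable_addA|exact: olson_le_order|].
  by move=> x y z; exact: observable_add_le.
exists (olson_join sigmaMV_E), (olson_meet sigmaMV_E); split.
  exact: olson_lattice.
exact: observable_add_joinl.
Qed.
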